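(* Fix an integer $g\ge 2$. There exist constants $c>0$ and $C>0$, depending only on $g$, such that for every integer $N\ge1$, \[ \sum_{\substack{m,n\in\Pi(2N+1)\\ \gcd(m,n)=1}} 1 = \frac{\rho(g)}{\zeta(2)} \Bigl(1-\frac{2}{g}\prod_{p\mid g}\frac{p}{p+1}\Bigr) \#\Pi(2N+1)^{2}\,\bigl(1+E_N\bigr) \quad\text{with}\quad |E_N|\le C g^{-c\sqrt{N}}, \] where the product is over primes $p$ dividing $g$, $\zeta$ is the Riemann zeta function, and \[ \rho(g)=\begin{cases}\bigl(\frac{g}{g-1}\bigr)^{2} & \text{if $g$ is even},\\[1mm] \frac{g+\frac13}{g-1} & \text{if $g$ is odd}.\end{cases} \]
   Context: Let $g\ge2$ be an integer (the base). Every positive integer $n$ has a unique base-$g$ expansion $n=\sum_{i=0}^{L-1}n_i g^i$ with $L\ge1$, digits $n_i\in\{0,\dots,g-1\}$ and $n_{L-1}\neq0$; $L$ is the length of $n$. A positive integer $n$ is a palindrome (in base $g$) if its digits satisfy $n_i=n_{L-1-i}$ for all $0\le i\le L-1$. For a positive integer $L$, $\Pi(L)$ denotes the set of palindromes of length $L$, and $\#$ denotes cardinality. *)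

(* Defs.v *)
From mathcomp Require Import all_boot all_order all_algebra.
From mathcomp Require Import all_classical all_reals all_analysis.

Set Implicit Arguments.
Unset Strict Implicit.
Unset Printing Implicit Defensive.

Import Order.TTheory GRing.Theory Num.Theory.
Import numFieldNormedType.Exports.

Local Open Scope nat_scope.

(** [d] lists the digits of [n] from the least significant one. *)
Definition is_expansion (g L n : nat) (d : {ffun 'I_L -> 'I_g}) : bool :=
  [&& 0 < L,
      n == \sum_(i < L) d i * g ^ i
    & [forall i : 'I_L, (i.+1 == L) ==> (d i != 0 :> nat)]].

(** [rev_ord i] has value [L - 1 - i]. *)
Definition is_palindrome (g L n : nat) : bool :=
  [exists d : {ffun 'I_L -> 'I_g},
    is_expansion n d && [forall i : 'I_L, d i == d (rev_ord i)]].

Lemma expansion_lt (g L n : nat) (d : {ffun 'I_L -> 'I_g}) :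
  is_expansion n d -> n < g ^ L.
Proof.
case/and3P=> _ /eqP -> _.
elim: L d => [|L IHL] d; first by rewrite big_ord0 expn0.
rewrite big_ord_recr /= expnS.
have lt_sum := IHL [ffun i => d (widen_ord (leqnSn L) i)].
rewrite (eq_bigr (fun i : 'I_L => d (widen_ord (leqnSn L) i) * g ^ i))
  in lt_sum; last by move=> i _; rewrite ffunE.
apply: (@leq_trans ((d ord_max).+1 * g ^ L)).
  by rewrite mulSn ltn_add2r.
by rewrite leq_mul2r ltn_ord orbT.
Qed.

(** The ambient type ['I_(g ^ L)] loses nothing, by [palindrome_lt]. *)
Lemma palindrome_lt (g L n : nat) : is_palindrome g L n -> n < g ^ L.
Proof. by case/existsP=> d /andP[/expansion_lt]. Qed.

Definition Pi (g L : nat) : {set 'I_(g ^ L)} :=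
  [set n : 'I_(g ^ L) | is_palindrome g L n].

Local Open Scope ring_scope.
Local Open Scope classical_set_scope.

(** Dirichlet series of the Riemann zeta function, meaningful for [1 < s]. *)
Definition zeta (R : realType) (s : R) : R :=
  limn (series (fun k : nat => (k.+1%:R `^ s)^-1)).

Definition rho (R : realType) (g : nat) : R :=
  if odd g then (g%:R + 3^-1) / (g%:R - 1) else (g%:R / (g%:R - 1)) ^+ 2.

(* Main.v *)
(** Write a palindrome of length [2N+1] with outer digit [a] and middle digit
    [e] as [x + v], where [x = a (1 + g^(2N)) + e g^N] and [v] is a combination
    of the weights [s_i = g^i + g^(2N-i)], [0 < i < N], with free digits below [g].
    Primes dividing [g] only see the outer digits, and, for odd [g], the prime 2
    only sees the middle digits; this produces the factor [rho] and the product
    over [p | g]. For the remaining primes Moebius inversion reduces the count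
    to the densities [Q_d(x)] of those [v] with [d | x + v], [d] squarefree and
    coprime to [2g], and one compares the sum of [mu(d) Q_d(x) Q_d(y)] with the
    sum of [mu(d) / d^2]. Choose [T] of order [sqrt N].

    For [d <= g^(4T)], [Q_d(x)] is within [g^(-5T)] of [1/d] by Fourier analysis
    modulo [d]: in every window of about [log d] consecutive positions, some
    factor of the exponential sum is bounded away from its maximum.

    For [g^(4k) < d <= g^(4k+4)], [k >= T], fixing all but the [2k-1] digits next
    to the middle leaves at most one solution, and by the Cauchy-Schwarz
    inequality [Q_d(x)^2] is at most [g^(1-2k)] times the collision probability
    modulo [d] of the next block of [4k] digits. Summed over [d], these
    probabilities are controlled by the number of squarefree divisors of the
    integers below [g^(12k)], so that the total contribution is [O(g^(-k))]. *)

Require Import Defs.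
From mathcomp Require Import all_boot all_order all_algebra.
From mathcomp Require Import all_classical all_reals all_analysis.
From mathcomp Require Import all_field zify ring lra.

Import Order.TTheory GRing.Theory Num.Theory.
Import numFieldNormedType.Exports.

(** * Digit sums and products of distinct primes *)

Local Open Scope nat_scope.

(** All sums of [n_x * x] over [x] in [s] with digits [n_x < g], with multiplicity. *)
Fixpoint digit_sums (g : nat) (s : seq nat) : seq nat :=
  if s is x :: s' then [seq n * x + v | n <- iota 0 g, v <- digit_sums g s'] else [:: 0].

Lemma size_digit_sums g s : size (digit_sums g s) = g ^ size s.
Proof. by elim: s => //= x s IH; rewrite size_allpairs size_iota IH expnS. Qed.

Lemma big_digit_sums_cat (V : nmodType) g s t (F : nat -> V) :
  (\sum_(v <- digit_sums g (s ++ t)) F v =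
   \sum_(v <- digit_sums g s) \sum_(w <- digit_sums g t) F (v + w)%N)%R.
Proof.
elim: s F => [|x s IH] F /=; first by rewrite big_seq1; apply: eq_bigr.
rewrite !big_allpairs_dep; apply: eq_bigr => n _; rewrite IH.
by apply: eq_bigr => v _; apply: eq_bigr => w _; rewrite addnA.
Qed.

Lemma digit_sums_scale g m s : digit_sums g [seq m * x | x <- s] = [seq m * v | v <- digit_sums g s].
Proof.
elim: s => [|x s IH] /=; first by rewrite muln0.
rewrite IH map_allpairs allpairs_mapr; apply: eq_allpairs => n v.
by rewrite mulnDr mulnCA.
Qed.

Lemma digit_sums_mod g M s t : [seq x %% M | x <- s] = [seq x %% M | x <- t] ->
  [seq v %% M | v <- digit_sums g s] = [seq v %% M | v <- digit_sums g t].
Proof.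
elim: s t => [|x s IH] [|y t] //= [exy /IH est].
rewrite !map_allpairs.
rewrite (eq_allpairs (f2 := fun n v => (n * x + v %% M) %% M)); last first.
  by move=> n v /=; rewrite modnDmr.
rewrite [RHS](eq_allpairs (f2 := fun n v => (n * y + v %% M) %% M)); last first.
  by move=> n v /=; rewrite modnDmr.
rewrite -(allpairs_mapr (fun n v => (n * x + v) %% M)) est allpairs_mapr.
by apply: eq_allpairs => n v /=; rewrite -modnDml -modnMmr exy modnMmr modnDml.
Qed.

(** Existence and uniqueness of base-[g] expansions: the units digit is the residue modulo [g], and
    the remaining weights are [g] times those of a shorter expansion. *)
Lemma perm_digit_sums_pow g m : 0 < g ->
  perm_eq (digit_sums g [seq g ^ i | i <- iota 0 m]) (iota 0 (g ^ m)).
Proof.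
move=> g0; elim: m => [|m IH] //.
have -> : [seq g ^ i | i <- iota 0 m.+1] = 1 :: [seq g * x | x <- [seq g ^ i | i <- iota 0 m]].
  rewrite /= expn0; congr cons.
  by rewrite -(addn0 1) iotaDl -!map_comp; apply: eq_map => i /=; rewrite add1n expnS.
rewrite [digit_sums _ _]/= digit_sums_scale allpairs_mapr.
apply: uniq_perm; [|exact: iota_uniq|].
  apply: allpairs_uniq; [exact: iota_uniq|by rewrite (perm_uniq IH) iota_uniq|].
  move=> [a b] [c d] /allpairsP[[a1 b1] /= [ha hb [-> ->]]].
  move=> /allpairsP[[c1 d1] /= [hc hd [-> ->]]].
  rewrite !muln1 => e; move: ha hc; rewrite !mem_iota /= !add0n => ha hc.
  have e1 : a1 = c1.
    by move/(congr1 (modn^~ g)): e; rewrite !(addnC _ (g * _)) !(mulnC g) !modnMDl !modn_small.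
  by move: e; rewrite e1 => /addnI/eqP; rewrite eqn_pmul2l // => /eqP ->.
move=> v; rewrite mem_iota /= add0n; apply/allpairsP/idP.
  move=> [[a b] /= [ha hb ->]]; move: ha hb; rewrite (perm_mem IH) !mem_iota /= !add0n muln1.
  move=> ha hb; rewrite expnS.
  apply: (@leq_trans (g + g * b)); first by rewrite ltn_add2r.
  by rewrite -mulnS leq_mul2l hb orbT.
move=> hv; exists (v %% g, v %/ g) => /=; split.
- by rewrite mem_iota /= ltn_mod.
- by rewrite (perm_mem IH) mem_iota /= ltn_divLR // mulnC -expnS.
- by rewrite muln1 {1}(divn_eq v g) addnC mulnC.
Qed.

Lemma digit_sums_bound g s v : v \in digit_sums g s -> v + sumn s <= g * sumn s.
Proof.
elim: s v => [|x s IH] v /=; first by rewrite inE => /eqP->.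
case/allpairsP => [[n w] /= [hn /IH hw ->]]; move: hn; rewrite mem_iota /= add0n => hn.
rewrite mulnDr addnACA leq_add // -mulSnr leq_mul2r hn orbT; done.
Qed.

(** The weight of the [i]-th digit, [i < P / 2], in a palindrome of length [P + 1]. *)
Definition pal_weight (g P i : nat) := g ^ i + g ^ (P - i).

(** Two geometric series, one from each half of the weights; negative terms are moved across to
    avoid truncated subtraction. *)
Lemma sumn_pal_weight g P m : 1 < g -> m <= P.+1 -> g.-1 * sumn [seq pal_weight g P i | i <- iota 0 m] + g ^ (P.+1 - m) + 1
   = g ^ P.+1 + g ^ m.
Proof.
move=> g1; elim: m => [|m IH] hm; first by rewrite muln0 subn0 expn0.
rewrite -addn1 iotaD map_cat sumn_cat /= addn0 add0n.
have := IH (ltnW hm).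
have -> : P.+1 - m = (P - m).+1 by rewrite subSn.
have -> : P.+1 - (m + 1) = P - m by lia.
rewrite /pal_weight expnD expn1 !expnS.
have : g = g.-1.+1 by lia.
move: (g ^ m) (g ^ (P - m)) (g ^ P) (sumn _) => x y z s ->; rewrite /=; nia.
Qed.

Lemma digit_sums_pal_lt g P m v : 1 < g -> m + m <= P.+1 -> v \in digit_sums g [seq pal_weight g P i | i <- iota 0 m] ->
  v < g ^ P.+1.
Proof.
move=> g1 hm hv; have := digit_sums_bound _ _ _ hv.
have h1 : m <= P.+1 by lia.
have := sumn_pal_weight g P m g1 h1.
have : g ^ m <= g ^ (P.+1 - m) by rewrite leq_pexp2l //; lia.
have : g = g.-1.+1 by lia.
move: (g ^ m) (g ^ (P.+1 - m)) (g ^ P.+1) (sumn _) => x y z s ->; rewrite /=; nia.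
Qed.

(* Modulo [g ^ m] only the lower half [g ^ i] of each weight survives, and base-[g] expansions are unique. *)
Lemma digit_sums_pal_mod_uniq g P m : 1 < g -> m + m <= P.+1 ->
  uniq [seq v %% g ^ m | v <- digit_sums g [seq pal_weight g P i | i <- iota 0 m]].
Proof.
move=> g1 hm.
rewrite (@digit_sums_mod _ _ _ [seq g ^ i | i <- iota 0 m]); last first.
  rewrite -!map_comp; apply/eq_in_map => i; rewrite mem_iota /= add0n => hi.
  have e : P - i = P - i - m + m by lia.
  rewrite /pal_weight e.
  by rewrite expnD addnC modnMDl.
have hp := perm_digit_sums_pow g m (ltnW g1).
rewrite (perm_uniq (perm_map _ hp)).
have -> : [seq v %% g ^ m | v <- iota 0 (g ^ m)] = iota 0 (g ^ m).
  rewrite -[RHS]map_id; apply/eq_in_map => i; rewrite mem_iota /= add0n => hi.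
  by rewrite modn_small.
exact: iota_uniq.
Qed.

Lemma digit_sums_pal_uniq g P m : 1 < g -> m + m <= P.+1 ->
  uniq (digit_sums g [seq pal_weight g P i | i <- iota 0 m]).
Proof. by move=> g1 /(digit_sums_pal_mod_uniq g P m g1); apply: map_uniq. Qed.

(** Lets an inner block of digits be treated as the outermost block of a palindrome shorter by [2a]
    digits. *)
Lemma pal_weight_shift g P a : a + a <= P -> forall m, m <= P - (a + a) ->
  [seq pal_weight g P i | i <- iota a m] = [seq g ^ a * x | x <- [seq pal_weight g (P - (a + a)) i | i <- iota 0 m]].
Proof.
move=> ha m hm; rewrite -[a in iota a m]addn0 iotaDl -!map_comp; apply/eq_in_map => i.
rewrite mem_iota /= add0n => hi; rewrite /pal_weight mulnDr -!expnD; congr (_ + _).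
by congr (g ^ _); lia.
Qed.

(** For distinct primes these are the divisors of their product, each listed once: the squarefree
    moduli of the sieve. *)
Fixpoint sqfree_prods (ps : seq nat) : seq nat :=
  if ps is p :: ps' then sqfree_prods ps' ++ [seq p * d | d <- sqfree_prods ps'] else [:: 1].

Lemma sqfree_prods_gt0 ps : all (ltn 0) ps -> all (ltn 0) (sqfree_prods ps).
Proof.
elim: ps => //= p ps IH /andP[p0 /IH h]; rewrite all_cat h /= all_map.
by apply: sub_all h => d /= d0; rewrite muln_gt0 p0.
Qed.

Lemma sqfree_prods_coprime q ps : all (fun p => coprime p q) ps -> all (fun p => coprime p q) (sqfree_prods ps).
Proof.
elim: ps => /= [|p ps IH /andP[p0 /IH h]]; first by rewrite coprime1n.
rewrite all_cat h /= all_map.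
by apply: sub_all h => d /= d0; rewrite coprimeMl p0.
Qed.

Definition distinct_primes (ps : seq nat) := uniq ps && all prime ps.

Lemma distinct_primes_cons p ps : distinct_primes (p :: ps) ->
  [/\ prime p, distinct_primes ps & all (fun q => coprime q p) ps].
Proof.
rewrite /distinct_primes /= => /andP[/andP[pps up] /andP[pp aps]]; split => //; first by rewrite up.
apply/allP => q qps; have pq := allP aps _ qps.
by rewrite prime_coprime // dvdn_prime2 //; apply: contraNneq pps => <-.
Qed.

Lemma uniq_sqfree_prods ps : distinct_primes ps -> uniq (sqfree_prods ps).
Proof.
elim: ps => //= p ps IH /distinct_primes_cons[pp hps hc].
rewrite cat_uniq IH //= map_inj_uniq ?IH ?andbT //; last first.
  by move=> a b /eqP; rewrite eqn_pmul2l ?prime_gt0 // => /eqP.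
apply/hasPn => _ /mapP[d hd ->]; apply/negP => /(allP (sqfree_prods_coprime _ _ hc)).
by rewrite coprimeMl /coprime gcdnn => /andP[/eqP h]; rewrite h in pp.
Qed.

(** A factor [p] can at most double the number of products dividing [n], and only when [p] itself
    divides [n]. *)
Lemma count_sqfree_prods_dvd ps n : count (fun d => d %| n) (sqfree_prods ps) <= 2 ^ count (fun p => p %| n) ps.
Proof.
elim: ps => /= [|p ps IH]; first by rewrite dvd1n.
rewrite count_cat count_map /= expnD.
have h : count (preim (muln p) (fun d => d %| n)) (sqfree_prods ps) <= (p %| n) * count (fun d => d %| n) (sqfree_prods ps).
  case: (boolP (p %| n)) => pn /=.
    by rewrite mul1n; apply: sub_count => d /=; apply: dvdn_trans; apply: dvdn_mull.
  rewrite mul0n leqn0; apply/eqP/eqP; rewrite -leqn0 leqNgt -has_count -all_predC.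
  apply/allP => d _ /=; apply: contra pn; apply: dvdn_trans; exact: dvdn_mulr.
apply: leq_trans (leq_add IH h) _; case: (p %| n); rewrite ?mul0n ?mul1n ?addn0 //.
by rewrite expn1 mul2n -addnn leq_add.
Qed.

Lemma prod_primes_dvd ps n : distinct_primes ps -> all (fun p => p %| n) ps ->
  \prod_(p <- ps) p %| n.
Proof.
elim: ps => [|p ps IH]; first by rewrite big_nil.
move=> /distinct_primes_cons[pp hps hc] /= /andP[pn hn]; rewrite big_cons Gauss_dvd; first by rewrite pn IH.
rewrite coprime_sym; elim: ps hc {IH hps hn} => [|q ps IH] /=; first by rewrite big_nil coprime1n.
by move=> /andP[qp /IH h]; rewrite big_cons coprimeMl qp.
Qed.

(** With [E = 2 ^ e], fewer than [E] primes lie below [E] and they contribute at most [E ^ E]; each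
    other prime divisor is at least [E], and their product divides [n]. *)
Lemma expn_count_primes e ps n : 0 < n -> distinct_primes ps ->
  (2 ^ e) ^ count (fun p => p %| n) ps <= (2 ^ e) ^ (2 ^ e) * n.
Proof.
move=> n0 /andP[ups pps].
rewrite -size_filter; set s := seq.filter _ _.
have us : uniq s by rewrite filter_uniq.
have hs : all prime s by apply/allP => p; rewrite mem_filter => /andP[_ /(allP pps)].
have dv : all (fun p => p %| n) s by apply: filter_all.
set E := 2 ^ e; have E0 : 0 < E by rewrite expn_gt0.
rewrite -(count_predC (fun p => p < E) s) expnD leq_mul //.
  rewrite leq_pexp2l // -size_filter -[leqRHS](size_iota 0) uniq_leq_size ?filter_uniq //.
  by move=> p; rewrite mem_filter mem_iota /= => /andP[].
rewrite -size_filter; set t := seq.filter _ s.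
apply: (@leq_trans (\prod_(p <- t) p)).
  have : all (fun p => E <= p) t.
    by apply/allP => p; rewrite mem_filter /= -leqNgt => /andP[].
  elim: t => [|p t IH] /=; first by rewrite big_nil.
  by move=> /andP[hp /IH h]; rewrite big_cons expnS leq_mul.
apply: dvdn_leq => //; apply: prod_primes_dvd.
  rewrite /distinct_primes filter_uniq //=; apply/allP => p; rewrite mem_filter => /andP[_]; exact: (allP hs).
by apply/allP => p; rewrite mem_filter => /andP[_]; exact: (allP dv).
Qed.

(** * Residue counts for large moduli *)

(** The divisor bound with exponent [1/e]: by [expn_count_primes] the [e]-th power of the count is
    at most [H ^ e * n], where [H = 2 ^ (2 ^ e)] is the [e]-th root of the constant there. *)
Lemma sqfree_divisor_bound e : 0 < e -> exists H, forall ps n g k,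
  0 < n -> distinct_primes ps -> n < g ^ (e * k) ->
  count (fun d => d %| n) (sqfree_prods ps) <= H * g ^ k.
Proof.
move=> e0; exists (2 ^ (2 ^ e)) => ps n g k n0 hps hn.
apply: leq_trans (count_sqfree_prods_dvd ps n) _.
rewrite -(@leq_exp2r _ _ e) // -expnM mulnC expnM.
apply: leq_trans (expn_count_primes e _ _ n0 hps) _.
rewrite expnMn -!expnM [2 ^ e * e]mulnC [k * e]mulnC.
by rewrite leq_mul2l (ltnW hn) orbT.
Qed.

Lemma cauchy_schwarz_nat (T : Type) (s : seq T) (f : T -> nat) :
  (\sum_(c <- s) f c) ^ 2 <= size s * \sum_(c <- s) f c ^ 2.
Proof.
elim: s => [|a s IH]; first by rewrite !big_nil.
rewrite !big_cons /=; move: (f a) (\sum_(c <- s) f c) (\sum_(c <- s) f c ^ 2) (size s) IH.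
move=> x S Q n IH.
suff h : 2 * (x * S) <= n * x ^ 2 + Q by rewrite sqrnD mulSn; nia.
case: n IH => [|n] IH.
  by move: IH; rewrite mul0n leqn0 expn_eq0 andbT => /eqP ->; rewrite !muln0.
rewrite -(@leq_pmul2l n.+1) //.
have := nat_Cauchy (n.+1 * x) S; rewrite mulnDr.
have -> : n.+1 * (2 * (x * S)) = 2 * (n.+1 * x * S) by ring.
have -> : n.+1 * (n.+1 * x ^ 2) = (n.+1 * x) ^ 2 by ring.
by move/leq_trans; apply; rewrite leq_add2l.
Qed.

(** Two solutions would make [d] divide [q] times their difference, hence the difference itself,
    which is smaller than [d]. *)
Lemma dvdn_add_inj (s : seq nat) d q X : uniq s -> all (fun c => c < d) s -> coprime d q ->
  \sum_(c <- s) (d %| X + q * c) <= 1.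
Proof.
move=> us hs cdq; rewrite -big_mkcond /= sum1_count -size_filter.
have : uniq (seq.filter (fun c => d %| X + q * c) s) by rewrite filter_uniq.
have hmem c : c \in seq.filter (fun c => d %| X + q * c) s -> d %| X + q * c /\ c < d.
  by rewrite mem_filter => /andP[-> /(allP hs)].
case: (seq.filter _ s) hmem => [|a [|b t]] // hm /=; rewrite inE negb_or => /andP[/andP[nab _] _].
have [da la] := hm a (mem_head _ _).
have [db lb] : d %| X + q * b /\ b < d by apply: hm; rewrite !inE eqxx orbT.
case/eqP: nab; clear hm; wlog ab : a b da la db lb / a <= b => [hw|].
  by case: (leqP a b) => [|/ltnW] h; [apply: hw|symmetry; apply: hw].
have := dvdn_sub db da; rewrite subnDl -mulnBr Gauss_dvdr // => h.
by case: (posnP (b - a)) => [|/dvdn_leq /(_ h)]; lia.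
Qed.

(* Cauchy-Schwarz over [U] and [C]: two solutions with the same [u] and [c] have congruent [b], [b']. *)
Lemma sum_sq_collision (U B C : seq nat) d x :
  (forall X, \sum_(c <- C) (d %| X + c) <= 1) ->
  (\sum_(u <- U) \sum_(b <- B) \sum_(c <- C) (d %| x + (u + (b + c)))) ^ 2
   <= size U ^ 2 * size C * \sum_(b <- B) \sum_(b' <- B) (b == b' %[mod d]).
Proof.
move=> hC; apply: leq_trans (cauchy_schwarz_nat _ _ _) _.
rewrite expnS expn1 -!mulnA leq_mul2l; apply/orP; right.
rewrite -sum1_size big_distrl /= leq_sum // => u _; rewrite mul1n exchange_big /=.
apply: leq_trans (cauchy_schwarz_nat _ _ _) _.
rewrite leq_mul2l; apply/orP; right.
under eq_bigr => c _ do rewrite expnS expn1 big_distrlr /=.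
rewrite exchange_big /= leq_sum // => b _; rewrite exchange_big /= leq_sum // => b' _.
case: eqP => hb /=.
  apply: leq_trans (hC (x + u + b)); apply: leq_sum => c _.
  by rewrite !addnA; case: (d %| x + u + b + c) => //; rewrite mul1n; case: (_ %| _).
rewrite big1 // => c _; apply/eqP; rewrite muln_eq0 !eqb0 -negb_and; apply/negP => /andP[h1 h2].
apply: hb; apply/eqP; rewrite -(eqn_modDr (x + u + c)).
have -> : b + (x + u + c) = x + (u + (b + c)) by lia.
have -> : b' + (x + u + c) = x + (u + (b' + c)) by lia.
by rewrite (eqP h1) (eqP h2).
Qed.

(** Sum over [d] first. A diagonal pair collides for every [d] in [D]; for any other pair [d], being
    coprime to [q], divides the nonzero difference. *)
Lemma sum_collision (D B : seq nat) q M L : uniq B ->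
  all (fun d => coprime d q) D -> size D <= M ->
  (forall b b', b \in B -> b' \in B -> b < b' -> count (fun d => d %| b' - b) D <= L) ->
  \sum_(d <- D) \sum_(b <- B) \sum_(b' <- B) (q * b == q * b' %[mod d])
    <= size B * M + size B ^ 2 * L.
Proof.
move=> uB cD sD hL.
have -> : \sum_(d <- D) \sum_(b <- B) \sum_(b' <- B) (q * b == q * b' %[mod d])
   = \sum_(b <- B) \sum_(b' <- B) \sum_(d <- D) (q * b == q * b' %[mod d]).
  by rewrite exchange_big; apply: eq_bigr => b _; rewrite exchange_big.
have hpair b b' : b \in B -> b' \in B ->
   \sum_(d <- D) (q * b == q * b' %[mod d]) <= (b' == b) * M + L.
  move=> hb hb'; case: eqP => [->|/eqP nb] /=.
    rewrite mul1n; apply: leq_trans (leq_addr _ _); apply: leq_trans sD.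
    by rewrite -sum1_size leq_sum // => d _; rewrite eqxx.
  rewrite mul0n add0n; wlog lt : b b' hb hb' nb / b < b' => [hw|].
    case: (ltngtP b b') => h; [exact: hw| |by rewrite h eqxx in nb].
    rewrite (eq_bigr (fun d => nat_of_bool (q * b' == q * b %[mod d]))); first by apply: hw; rewrite // eq_sym.
    by move=> d _; rewrite eq_sym.
  apply: leq_trans (hL _ _ hb hb' lt).
  rewrite -sum1_count [leqRHS]big_mkcond /= [leqLHS]big_seq [leqRHS]big_seq leq_sum // => d hd.
  rewrite eq_sym eqn_mod_dvd ?leq_mul2l ?(ltnW lt) ?orbT // -mulnBr Gauss_dvdr; last exact: (allP cD).
  by case: (d %| _).
apply: (@leq_trans (\sum_(b <- B) (M + size B * L))).
  rewrite [leqLHS]big_seq [leqRHS]big_seq leq_sum // => b hb.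
  apply: (@leq_trans (\sum_(b' <- B) ((b' == b) * M + L))).
    by rewrite [leqLHS]big_seq [leqRHS]big_seq leq_sum // => b' hb'; apply: hpair.
  rewrite big_split /= -big_distrl /= leq_add //.
    by rewrite -big_mkcond /= sum1_count count_uniq_mem // hb mul1n.
  by rewrite big_const_seq count_predT iter_addn_0 mulnC.
by rewrite big_const_seq count_predT iter_addn_0; nia.
Qed.

(** [x] carries the contribution of the outer and middle digits. *)
Definition dvd_count g N d x := \sum_(v <- digit_sums g [seq pal_weight g (2 * N) i | i <- iota 1 N.-1]) (d %| x + v).

(** From the outside in: [r] digits to be fixed, [l] digits whose collisions are counted, and [j]
    digits next to the middle that are determined modulo large [d]. *)
Lemma dvd_count_split g N d x r l j : 1 < g -> r + l + j = N.-1 -> 0 < N ->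
  dvd_count g N d x = \sum_(u <- digit_sums g [seq pal_weight g (2 * N) i | i <- iota 1 r])
    \sum_(b <- [seq g ^ (1 + r) * v | v <- digit_sums g [seq pal_weight g (2 * (l + j)) i | i <- iota 0 l]])
    \sum_(c <- [seq g ^ (1 + r + l) * v | v <- digit_sums g [seq pal_weight g (2 * j) i | i <- iota 0 j]])
     (d %| x + (u + (b + c))).
Proof.
move=> g1 hN N0; rewrite /dvd_count -hN -addnA iotaD map_cat.
rewrite (big_digit_sums_cat nat); apply: eq_bigr => u _.
rewrite iotaD map_cat big_digit_sums_cat.
rewrite (@pal_weight_shift g (2 * N) (1 + r)); [|lia..].
rewrite (@pal_weight_shift g (2 * N) (1 + r + l)); [|lia..].
rewrite !digit_sums_scale.
have -> : 2 * N - (1 + r + (1 + r)) = 2 * (l + j) by lia.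
by have -> : 2 * N - (1 + r + l + (1 + r + l)) = 2 * j by lia.
Qed.

Lemma mid_block_inj g j a d X : 1 < g -> coprime d g -> g ^ (2 * j).+1 <= d ->
  \sum_(c <- [seq g ^ a * v | v <- digit_sums g [seq pal_weight g (2 * j) i | i <- iota 0 j]]) (d %| X + c) <= 1.
Proof.
move=> g1 cd hd; rewrite big_map; apply: dvdn_add_inj.
- by apply: digit_sums_pal_uniq => //; lia.
- by apply/allP => v /digit_sums_pal_lt h; apply: leq_trans (h g1 _) hd; lia.
- by rewrite coprimeXr.
Qed.

Lemma sum_dvd_count_sq_block g : 1 < g -> exists C, forall ps N k x,
  distinct_primes ps -> all (fun p => coprime p g) ps -> 0 < k -> 6 * k <= N ->
  (\sum_(d <- sqfree_prods ps | g ^ (4 * k) < d <= g ^ (4 * k + 4)) dvd_count g N d x ^ 2) * g ^ k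
    <= C * g ^ (2 * N.-1).
Proof.
move=> g1; have g0 : 0 < g by lia.
have [H HH] := sqfree_divisor_bound 12 isT.
exists (g * (g ^ 4 + H)) => ps N k x hps cps k0 kN.
(* With [j = 2k - 1] the middle block, up to a power of [g], is below [g ^ (4k - 1) < d], hence
   injective modulo [d]. With [l = 4k] the diagonal collisions, [g ^ l] for each of at most
   [g ^ (4k + 4)] moduli, cost only [g ^ 4 * g ^ (2l)]. Differences in the [l]-block are below
   [g ^ (12k)], whence the exponent 12 in the divisor bound. *)
set r := N - 6 * k; set l := 4 * k; set j := 2 * k - 1.
have hsum : r + l + j = N.-1 by rewrite /r /l /j; lia.
have N0 : 0 < N by lia.
rewrite -big_filter; set D := seq.filter _ _.
pose B := digit_sums g [seq pal_weight g (2 * (l + j)) i | i <- iota 0 l].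
have hB : l + l <= (2 * (l + j)).+1 by rewrite /l /j; lia.
have uB : uniq B by apply: digit_sums_pal_uniq.
have sB : size B = g ^ l by rewrite size_digit_sums size_map size_iota.
have hD d : d \in D -> [/\ d \in sqfree_prods ps, g ^ (4 * k) < d, d <= g ^ (4 * k + 4) & coprime d g].
  rewrite mem_filter => /andP[/andP[h1 h2] h3]; split => //.
  exact: (allP (sqfree_prods_coprime _ _ cps)).
have bd d : d \in D -> dvd_count g N d x ^ 2 <=
   (g ^ r) ^ 2 * g ^ j * \sum_(b <- B) \sum_(b' <- B) (g ^ (1 + r) * b == g ^ (1 + r) * b' %[mod d]).
  move=> /hD[_ hd1 hd2 hd3]; rewrite (@dvd_count_split g N d x r l j) //.
  apply: leq_trans (sum_sq_collision _ _ _ _ _ _) _.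
    move=> X; apply: mid_block_inj => //; apply: leq_trans (ltnW hd1).
    by rewrite leq_pexp2l // /j; lia.
  rewrite !size_map !size_digit_sums !size_map !size_iota big_map.
  by under eq_bigr => b _ do rewrite big_map.
apply: (@leq_trans (((g ^ r) ^ 2 * g ^ j * (g ^ l * g ^ (4 * k + 4) + (g ^ l) ^ 2 * (H * g ^ k))) * g ^ k)).
  rewrite leq_mul2r; apply/orP; right.
  apply: (@leq_trans (\sum_(d <- D) ((g ^ r) ^ 2 * g ^ j * \sum_(b <- B) \sum_(b' <- B) (g ^ (1 + r) * b == g ^ (1 + r) * b' %[mod d])))).
    by rewrite [leqLHS]big_seq [leqRHS]big_seq leq_sum.
  rewrite -big_distrr /= leq_mul2l; apply/orP; right; rewrite -sB.
  apply: sum_collision => //.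
  - by apply/allP => d /hD[_ _ _ h]; rewrite coprimeXr.
  - rewrite -[leqRHS](size_iota 1) uniq_leq_size ?filter_uniq ?uniq_sqfree_prods //.
    move=> d /hD[h1 h2 h3 h4]; rewrite mem_iota add1n ltnS h3 andbT.
    by apply: leq_trans h2.
  - move=> b b' hb hb' lt; apply: (@leq_trans (count (fun d => d %| b' - b) (sqfree_prods ps))).
      by rewrite -!size_filter /D -filter_predI size_filter size_filter; apply: sub_count => d /andP[].
    apply: HH => //; first by rewrite subn_gt0.
    apply: leq_ltn_trans (leq_subr _ _) _.
    apply: leq_trans (digit_sums_pal_lt _ _ _ _ g1 hB hb') _.
    by rewrite leq_pexp2l // /l /j; lia.
have -> : g ^ (4 * k + 4) = g ^ l * g ^ 4 by rewrite expnD.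
have -> : 2 * N.-1 = r + r + j + (l + l) + j by rewrite -hsum; lia.
(* The saving is one factor [g ^ j = g ^ (2k - 1)]: one [g ^ k] pays for the divisor bound, the
   other is the factor in the conclusion. *)
have e2 : g ^ k * g ^ k = g * g ^ j by rewrite -expnD -expnS; congr (g ^ _); rewrite /j; lia.
have k1 : 0 < g ^ k by rewrite expn_gt0 g0.
clear bd hD hB sB uB; clearbody l j r; rewrite !expnD -!mulnn.
move: e2 k1; move: (g ^ r) (g ^ j) (g ^ l) (g ^ k) => R J L K e2 k1.
have -> : R * R * J * (L * (L * g ^ 4) + L * L * (H * K)) * K
   = R * R * J * (L * L) * (g ^ 4 * K + H * (K * K)) by ring.
have -> : g * (g ^ 4 + H) * (R * R * J * (L * L) * J) = R * R * J * (L * L) * ((g ^ 4 + H) * (g * J)) by ring.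
rewrite leq_mul2l; apply/orP; right; rewrite -e2 mulnDl leq_add2r.
by rewrite leq_mul2l leq_pmull ?orbT.
Qed.

(** For [6k] within 6 of [N] all remaining [d] are treated at once. One factor of the square is at
    most [g ^ r], since the digits next to the middle have at most one solution; the other is summed
    over [d] by the divisor bound for [x + v], which is positive and below [g ^ (12 (k + 2))]. *)
Lemma sum_dvd_count_sq_large g : 1 < g -> exists C, forall ps N k x,
  distinct_primes ps -> all (fun p => coprime p g) ps -> 0 < k -> 6 * k <= N -> N < 6 * k + 6 ->
  0 < x -> x <= g ^ (2 * N + 1) ->
  (\sum_(d <- sqfree_prods ps | g ^ (4 * k) < d) dvd_count g N d x ^ 2) * g ^ k
    <= C * g ^ (2 * N.-1).
Proof.
move=> g1; have g0 : 0 < g by lia.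
have [H HH] := sqfree_divisor_bound 12 isT.
exists (g ^ 3 * H) => ps N k x hps cps k0 kN Nk x0 hx.
set j := 2 * k - 1; set r := N.-1 - j.
have hsum : r + 0 + j = N.-1 by rewrite /r /j; lia.
have N0 : 0 < N by lia.
have bd d : d \in sqfree_prods ps -> g ^ (4 * k) < d -> dvd_count g N d x <= g ^ r.
  move=> hd hd1; rewrite (@dvd_count_split g N d x r 0 j) //=.
  apply: (@leq_trans (\sum_(u <- digit_sums g [seq pal_weight g (2 * N) i | i <- iota 1 r]) 1)).
    rewrite leq_sum // => u _; rewrite muln0 big_seq1.
    under eq_bigr => c _ do rewrite add0n addnA.
    apply: mid_block_inj => //; first exact: (allP (sqfree_prods_coprime _ _ cps)).
    by apply: leq_trans (ltnW hd1); rewrite leq_pexp2l // /j; lia.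
  by rewrite sum1_size size_digit_sums size_map size_iota.
apply: (@leq_trans (g ^ r * (g ^ N.-1 * (H * g ^ (k + 2))) * g ^ k)).
  rewrite leq_mul2r; apply/orP; right.
  apply: (@leq_trans (g ^ r * \sum_(d <- sqfree_prods ps) dvd_count g N d x)).
    rewrite big_distrr /= big_mkcond /= [leqLHS]big_seq [leqRHS]big_seq leq_sum // => d hd.
    by case: ifP => // h; rewrite expnS expn1 leq_mul2r bd ?orbT.
  rewrite leq_mul2l; apply/orP; right; rewrite /dvd_count exchange_big /=.
  have -> : g ^ N.-1 * (H * g ^ (k + 2)) = \sum_(v <- digit_sums g [seq pal_weight g (2 * N) i | i <- iota 1 N.-1]) (H * g ^ (k + 2)).
    by rewrite big_const_seq count_predT iter_addn_0 size_digit_sums size_map size_iota mulnC.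
  rewrite [leqLHS]big_seq [leqRHS]big_seq leq_sum // => v hv.
  rewrite -big_mkcond /= sum1_count; apply: HH => //; first by rewrite addn_gt0 x0.
  move: hv; rewrite (@pal_weight_shift g (2 * N) 1); [|lia..].
  rewrite digit_sums_scale => /mapP[w hw ->].
  have hw2 : w < g ^ (2 * N - 2).+1 by apply: digit_sums_pal_lt hw => //; lia.
  have -> : 12 * (k + 2) = (2 * N + 1) + (12 * (k + 2) - (2 * N + 1)) by lia.
  apply: (@leq_trans (g ^ (2 * N + 1) * g ^ 1)); last by rewrite -expnD leq_pexp2l //; lia.
  rewrite expn1 in hw2 *; move: hw2.
  have -> : g ^ (2 * N + 1) = g * (g * g ^ (2 * N - 2).+1) by rewrite -!expnS; congr (g ^ _); lia.
  move: hx.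
  have -> : g ^ (2 * N + 1) = g * (g * g ^ (2 * N - 2).+1) by rewrite -!expnS; congr (g ^ _); lia.
  move: (g ^ (2 * N - 2).+1) => y; nia.
have -> : 2 * N.-1 = N.-1 + r + j by rewrite -hsum; lia.
have e2 : g ^ k * g ^ k = g * g ^ j by rewrite -expnD -expnS; congr (g ^ _); rewrite /j; lia.
rewrite !expnD; move: e2; move: (g ^ r) (g ^ j) (g ^ N.-1) (g ^ k) => R J L K e2.
have -> : R * (L * (H * (K * g ^ 2))) * K = R * L * H * g ^ 2 * (K * K) by ring.
by rewrite e2 leq_eqVlt; apply/orP; left; apply/eqP; rewrite expnS; ring.
Qed.

Local Open Scope ring_scope.

(** * Equidistribution for small moduli *)

Lemma norm_expr_sub1 (F : numDomainType) (c : F) n : `|c| = 1 -> `|c ^+ n - 1| <= n%:R * `|c - 1|.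
Proof.
move=> c1; rewrite subrX1 normrM mulrC ler_wpM2r //.
apply: le_trans (ler_norm_sum _ _ _) _.
rewrite (eq_bigr (fun=> 1)); last by move=> i _; rewrite normrX c1 expr1n.
by rewrite sumr_const card_ord.
Qed.

Lemma norm_geom_sub (F : numDomainType) (c : F) n : `|c| = 1 ->
  `|\sum_(k < n) c ^+ k - n%:R| <= n%:R ^+ 2 * `|c - 1|.
Proof.
move=> c1; have -> : n%:R = \sum_(k < n) (1 : F) by rewrite sumr_const card_ord.
rewrite -sumrB sumr_const card_ord.
apply: le_trans (ler_norm_sum _ _ _) _.
apply: (@le_trans _ _ (\sum_(k < n) n%:R * `|c - 1|)).
  apply: ler_sum => k _; apply: le_trans (norm_expr_sub1 _ _ _ c1) _.
  by rewrite ler_wpM2r // ler_nat ltnW.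
by rewrite sumr_const card_ord -[leLHS]mulr_natl expr2 mulrA.
Qed.

(* For a root of unity [c <> 1] the geometric sum vanishes, so [c] cannot be too close to 1. *)
Lemma norm_root_sub1 (F : numFieldType) (c : F) d : (0 < d)%N -> `|c| = 1 -> c ^+ d = 1 -> c != 1 ->
  d%:R^-1 <= `|c - 1|.
Proof.
move=> d0 c1 cd cn1; have := norm_geom_sub _ c d c1.
have : (c - 1) * (\sum_(k < d) c ^+ k) = 0 by rewrite -subrX1 cd subrr.
move/eqP; rewrite mulf_eq0 subr_eq0 (negbTE cn1) /= => /eqP ->.
rewrite sub0r normrN normr_nat expr2 -mulrA -[leLHS]mulr1 ler_pM2l ?ltr0n // => h.
by rewrite -div1r ler_pdivrMr ?ltr0n // mulrC.
Qed.

(** The quotient of [c ^ g - 1] by [c - 1] is a geometric sum within [1/2] of [g], hence at least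
    [3/2] in norm. *)
Lemma norm_expr_growth (F : numFieldType) (c : F) g : (1 < g)%N -> `|c| = 1 ->
  `|c - 1| <= (2 * g%:R ^+ 2)^-1 -> 3 / 2 * `|c - 1| <= `|c ^+ g - 1|.
Proof.
move=> g1 c1 hc; rewrite subrX1 normrM mulrC ler_wpM2l //.
have h := norm_geom_sub _ c g c1.
have g0 : 0 < g%:R :> F by rewrite ltr0n; lia.
have h2 : `|\sum_(k < g) c ^+ k - g%:R| <= 2^-1.
  apply: le_trans h _; apply: (@le_trans _ _ (g%:R ^+ 2 * (2 * g%:R ^+ 2)^-1)).
    by rewrite ler_wpM2l // exprn_ge0 // ltW.
  by rewrite invfM mulrCA divff ?mulr1 // expf_neq0 // lt0r_neq0.
have h3 : g%:R <= `|\sum_(k < g) c ^+ k - g%:R| + `|\sum_(k < g) c ^+ k|.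
  rewrite distrC; apply: le_trans (ler_normD _ _).
  by rewrite subrK ger0_norm // ltW.
have h4 : (2 : F) <= g%:R by rewrite (ler_nat F 2 g).
have h5 : g%:R <= 2^-1 + `|\sum_(k < g) c ^+ k| by apply: le_trans h3 _; rewrite lerD2r.
have h6 : (2 : F) <= 2^-1 + `|\sum_(k < g) c ^+ k| by apply: le_trans h4 h5.
rewrite -lerBlDl in h6; apply: le_trans h6.
by rewrite le_eqVlt; apply/orP; left; apply/eqP; field.
Qed.

(** The parallelogram law gives [|1 + c|^2 = 4 - |c - 1|^2], and [4 - e^2] is at most the square of
    [2 - e^2 / 4]. *)
Lemma norm_1D (c e : algC) : `|c| = 1 -> 0 <= e -> e <= 1 -> e <= `|c - 1| ->
  `|1 + c| <= 2 - e ^+ 2 / 4.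
Proof.
move=> c1 e0 e1 hc.
have e21 : e ^+ 2 <= 1 by rewrite expr_le1.
have hp : 0 <= 2 - e ^+ 2 / 4.
  rewrite subr_ge0; apply: (@le_trans _ _ 1); last by rewrite (ler_nat _ 1 2).
  rewrite ler_pdivrMr ?ltr0n // mul1r; apply: le_trans e21 _; by rewrite (ler_nat _ 1 4).
rewrite -(@ler_pXn2r _ 2) ?nnegrE //.
have par : `|1 + c| ^+ 2 + `|c - 1| ^+ 2 = 4.
  have : c * c^* = 1 by rewrite -normCK c1 expr1n.
  rewrite !normCK !rmorphD rmorphN /= rmorph1 => h.
  have -> : (1 + c) * (1 + c^*) + (c - 1) * (c^* - 1) = 2 + 2 * (c * c^*) by ring.
  by rewrite h; ring.
have h2 : e ^+ 2 <= `|c - 1| ^+ 2 by rewrite ler_pXn2r ?nnegrE.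
have -> : `|1 + c| ^+ 2 = 4 - `|c - 1| ^+ 2 by rewrite -par addrK.
apply: (@le_trans _ _ (4 - e ^+ 2)); first by rewrite lerD2l lerN2.
have -> : (2 - e ^+ 2 / 4) ^+ 2 = 4 - e ^+ 2 + e ^+ 2 ^+ 2 / 16 by field.
by rewrite lerDl divr_ge0 ?exprn_ge0 // ler0n.
Qed.

(** All the cancellation is taken from the first two terms; the others are bounded by 1. *)
Lemma norm_geom_le (c e : algC) g : (1 < g)%N -> `|c| = 1 -> 0 <= e -> e <= 1 -> e <= `|c - 1| ->
  `|\sum_(k < g) c ^+ k| <= g%:R - e ^+ 2 / 4.
Proof.
case: g => [|[|g]] // _ c1 e0 e1 hc; rewrite !big_ord_recl addrA.
apply: le_trans (ler_normD _ _) _.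
have -> : g.+2%:R - e ^+ 2 / 4 = (2 - e ^+ 2 / 4) + g%:R :> algC by rewrite -addn2 natrD; ring.
apply: lerD; first by rewrite expr0 /= expr1; apply: norm_1D.
apply: le_trans (ler_norm_sum _ _ _) _.
rewrite (eq_bigr (fun=> 1)); last by move=> i _; rewrite normrX c1 expr1n.
by rewrite sumr_const card_ord.
Qed.

Lemma sum_expr_digit_sums (F : comNzRingType) g s (w : F) :
  \sum_(v <- digit_sums g s) w ^+ v = \prod_(x <- s) \sum_(k < g) (w ^+ x) ^+ k.
Proof.
elim: s => [|x s IH] /=; first by rewrite big_nil big_seq1.
rewrite big_cons big_allpairs_dep -IH mulr_suml.
rewrite -(big_mkord xpredT (fun k => w ^+ x ^+ k * _)) /index_iota subn0.
apply: eq_bigr => n _; rewrite mulr_sumr; apply: eq_bigr => v _.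
by rewrite exprD mulnC exprM.
Qed.

Lemma norm_root1 (F : numDomainType) (w : F) d : (0 < d)%N -> w ^+ d = 1 -> `|w| = 1.
Proof.
move=> d0 wd; apply/eqP; rewrite -(@pexpr_eq1 _ _ d) // -?normrX ?wd ?normr1 //.
Qed.

Lemma expr_coprime_eq1 (F : fieldType) (v : F) d e : coprime d e -> v ^+ d = 1 -> v ^+ e = 1 -> v = 1.
Proof.
case: (posnP d) => [->|d0].
  by rewrite /coprime gcd0n => /eqP -> _; rewrite expr1.
move=> cde vd ve; have [a b hab _] := egcdnP e d0.
move: cde => /eqP gde; rewrite gde in hab.
have : v ^+ (b * e + 1) = v by rewrite exprD mulnC exprM ve expr1n mul1r.
by rewrite -hab mulnC exprM vd expr1n.
Qed.

Lemma expr_pow_even (F : nzRingType) (w : F) g a t : w ^+ (g ^ 2) = w ->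
  w ^+ (g ^ (a + 2 * t)) = w ^+ (g ^ a).
Proof.
move=> hw; elim: t => [|t IH]; first by rewrite muln0 addn0.
have -> : (a + 2 * t.+1 = 2 + (a + 2 * t))%N by lia.
by rewrite expnD exprM hw.
Qed.

(* Put [c_i = w ^ s_i] and [v_i = w ^ ((g^2 - 1) g^(2N-i))]. Then [c_i ^ g = c_(i+1) v_(i+1)] and
   [v_i = v_(i+1) ^ g]: if all [c_i] in the window were close to 1, so would be all [v_i], whereas
   the distance of [v_i] to 1 grows by 3/2 at each step down, starting from [1/d], unless [v_i = 1].
   In that last case [w ^ g^2 = w], and [c_i = w ^ (2 g^i)] is a nontrivial root of unity of order
   dividing [g^2 - 1]. *)
Lemma window_exists (w : algC) g d N i0 K : (1 < g)%N -> odd d -> coprime d g ->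
  w ^+ d = 1 -> w != 1 -> (d%:R : algC) <= (3 / 2) ^+ K -> (i0 + K < N)%N ->
  exists2 i, (i0 <= i < i0 + K.+2)%N & (2 * g%:R ^+ 4)^-1 <= `|w ^+ pal_weight g (2 * N) i - 1|.
Proof.
move=> g1 od cdg wd wn1 hK hN.
have d0 : (0 < d)%N by case: d od {cdg wd hK}.
have gp : (0 < g)%N by lia.
have g0 : 0 < g%:R :> algC by rewrite ltr0n.
have w1 : `|w| = 1 by apply: norm_root1 d0 wd.
have wX n : `|w ^+ n| = 1 by rewrite normrX w1 expr1n.
set e := (2 * g%:R ^+ 4)^-1.
have e0 : 0 <= e by rewrite invr_ge0 mulr_ge0 ?exprn_ge0 ?ler0n.
case: (boolP (has (fun i => e <= `|w ^+ pal_weight g (2 * N) i - 1|) (iota i0 K.+2))) => [/hasP[i]|/hasPn hn].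
  by rewrite mem_iota => hi he; exists i.
have small i : (i0 <= i < i0 + K.+2)%N -> `|w ^+ pal_weight g (2 * N) i - 1| <= e.
  move=> hi; have /hn : i \in iota i0 K.+2 by rewrite mem_iota.
  by have := real_leVge (ger0_real e0) (normr_real (w ^+ pal_weight g (2 * N) i - 1)) => /orP[->|].
pose v i := w ^+ ((g ^ 2 - 1) * g ^ (2 * N - i)).
have vX i : (i < 2 * N)%N -> v i = v i.+1 ^+ g.
  move=> hi; rewrite /v -exprM; congr (_ ^+ _).
  have -> : (2 * N - i = (2 * N - i.+1).+1)%N by lia.
  by rewrite (expnS g (2 * N - i.+1)) [(g * _)%N]mulnC mulnA.
have hv i : (i0 <= i < i0 + K.+1)%N -> `|v i.+1 - 1| <= (2 * g%:R ^+ 2)^-1.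
  move=> /andP[h1 h2].
  have rel : (w ^+ pal_weight g (2 * N) i) ^+ g = w ^+ pal_weight g (2 * N) i.+1 * v i.+1.
    rewrite /v -exprM -exprD /pal_weight; congr (_ ^+ _).
    have -> : (2 * N - i = (2 * N - i.+1).+1)%N by lia.
    rewrite !expnS; move: (g ^ i)%N (g ^ _)%N => x y; rewrite expn0 muln1; nia.
  have -> : `|v i.+1 - 1| = `|w ^+ pal_weight g (2 * N) i.+1 * v i.+1 - w ^+ pal_weight g (2 * N) i.+1|.
    by rewrite -{2}[w ^+ _]mulr1 -mulrBr normrM wX mul1r.
  rewrite -rel; apply: le_trans (ler_distD 1 _ _) _.
  apply: (@le_trans _ _ (g%:R * e + e)).
    apply: lerD; last by rewrite distrC; apply: small; lia.
    apply: le_trans (norm_expr_sub1 _ _ _ (wX _)) _.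
    by rewrite ler_wpM2l ?small // ?ltW //; lia.
  rewrite -{2}[e]mul1r -mulrDl /e ler_pdivrMr ?mulr_gt0 ?exprn_gt0 ?ltr0n //.
  have -> : (2 * g%:R ^+ 2)^-1 * (2 * g%:R ^+ 4) = g%:R ^+ 2 :> algC by field; rewrite lt0r_neq0.
  by rewrite natr1 -natrX ler_nat; nia.
have [vi1|vn1] := eqVneq (v (i0 + K.+1)%N) 1.
  have wg : w ^+ (g ^ 2 - 1) = 1.
    apply: (expr_coprime_eq1 _ _ d (g ^ (2 * N - (i0 + K.+1)))); first by rewrite coprimeXr.
      by rewrite -exprM mulnC exprM wd expr1n.
    by rewrite -exprM.
  have wg2 : w ^+ (g ^ 2) = w.
    have -> : (g ^ 2 = (g ^ 2 - 1).+1)%N by rewrite -subSn ?subSS ?subn0 // expn_gt0; lia.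
    by rewrite exprS wg mulr1.
  have c0 : w ^+ pal_weight g (2 * N) i0 = (w ^+ 2) ^+ (g ^ i0).
    rewrite /pal_weight exprD.
    have -> : (2 * N - i0 = i0 + 2 * (N - i0))%N by lia.
    by rewrite expr_pow_even // -exprD -exprM addnn mul2n.
  (* Here [d] odd enters: [d] is coprime to [2 g^i0], so a trivial value would force [w = 1]. *)
  have cn1 : w ^+ pal_weight g (2 * N) i0 != 1.
    rewrite c0 -exprM; apply: contraNneq wn1 => h; apply/eqP.
    apply: (expr_coprime_eq1 _ _ d (2 * g ^ i0)) => //.
    by rewrite coprimeMr coprimeXr // coprimen2 od.
  have := norm_root_sub1 _ (w ^+ pal_weight g (2 * N) i0) (g ^ 2 - 1) _ (wX _) _ cn1.
  have gg : (1 < g ^ 2)%N by rewrite -(expn0 g) ltn_exp2l.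
  rewrite subn_gt0 => /(_ gg); rewrite -exprM mulnC exprM wg expr1n => /(_ erefl) h.
  have : (g ^ 2 - 1)%:R^-1 <= e by apply: le_trans h (small _ _); lia.
  rewrite /e lef_pV2 ?posrE ?ltr0n ?subn_gt0 // ?mulr_gt0 ?exprn_gt0 ?ltr0n //.
  rewrite -natrX -natrM ler_nat; nia.
have grow t : (t <= K)%N -> (3 / 2) ^+ t * `|v (i0 + K.+1)%N - 1| <= `|v (i0 + (K - t).+1)%N - 1|.
  elim: t => [|t IH] ht; first by rewrite expr0 mul1r subn0.
  have h1 := IH (ltnW ht).
  rewrite exprS -mulrA.
  have -> : v (i0 + (K - t.+1).+1)%N = v (i0 + (K - t).+1)%N ^+ g.
    have -> : (i0 + (K - t).+1 = (i0 + (K - t.+1).+1).+1)%N by lia.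
    by rewrite -vX //; lia.
  have hs : `|v (i0 + (K - t).+1)%N - 1| <= (2 * g%:R ^+ 2)^-1 by rewrite addnS; apply: hv; lia.
  apply: le_trans (norm_expr_growth _ _ _ g1 (wX _) hs).
  by rewrite ler_wpM2l // divr_ge0 ?ler0n.
have := grow K (leqnn _); rewrite subnn addn1 => h1.
have h2 : `|v i0.+1 - 1| <= (2 * g%:R ^+ 2)^-1 by apply: hv; lia.
have h3 : d%:R^-1 <= `|v (i0 + K.+1)%N - 1|.
  by apply: norm_root_sub1 d0 (wX _) _ vn1; rewrite /v -exprM mulnC exprM wd expr1n.
(* After [K] steps the growth [(3/2) ^ K >= d] outweighs the initial distance [1/d], which
   contradicts the smallness at the end of the window. *)
have : 1 <= (2 * g%:R ^+ 2)^-1 :> algC.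
  apply: le_trans h2; apply: le_trans h1.
  apply: (@le_trans _ _ (d%:R * d%:R^-1)); first by rewrite divff // pnatr_eq0 -lt0n.
  apply: ler_pM => //; by rewrite ?invr_ge0 ler0n.
rewrite invr_ge1 ?unitfE ?lt0r_neq0 ?mulr_gt0 ?exprn_gt0 ?ltr0n //.
rewrite -natrX -natrM (ler_nat _ _ 1); nia.
Qed.

(** The range contains [W] disjoint windows of length [L]; each supplies one factor at most [q], and
    all other factors are at most 1. *)
Lemma prod_windows (F : numDomainType) (f : nat -> F) q L W M a :
  (forall i, 0 <= f i <= 1) -> 0 <= q ->
  (forall i0, (a <= i0)%N -> (i0 + L <= a + M)%N -> exists2 i, (i0 <= i < i0 + L)%N & f i <= q) ->
  (L * W <= M)%N -> \prod_(i <- iota a M) f i <= q ^+ W.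
Proof.
move=> f01 q0.
have p01 s : 0 <= \prod_(i <- s) f i <= 1.
  elim: s => [|i s IH]; first by rewrite big_nil ler01 lexx.
  rewrite big_cons; case/andP: (f01 i) => ? ?; case/andP: IH => ? ?.
  by rewrite mulr_ge0 //= mulr_ile1.
elim: W a M => [|W IH] a M hf hM; first by rewrite expr0; case/andP: (p01 (iota a M)).
have e : (M = L + (M - L))%N by lia.
rewrite e iotaD big_cat /= exprS.
have /andP[? ?] := p01 (iota a L); have /andP[? ?] := p01 (iota (a + L) (M - L)).
apply: ler_pM => //; last first.
  by apply: IH => [i0 h1 h2|]; [apply: hf; lia|lia].
have [|i hi fi] := hf a (leqnn _); first lia.
have -> : (L = (i - a) + (1 + (L - (i - a) - 1)))%N by lia.
rewrite iotaD big_cat iotaD big_cat /= big_seq1 subnKC; last by lia.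
have /andP[? ?] := p01 (iota a (i - a)).
have /andP[? ?] := p01 (iota (i + 1) (L - (i - a) - 1)).
have /andP[? ?] := f01 i.
apply: (@le_trans _ _ (1 * (q * 1))); last by rewrite mul1r mulr1.
by apply: ler_pM => //; [apply: mulr_ge0|apply: ler_pM].
Qed.

Lemma sum_root_unity (z : algC) d n : d.-primitive_root z ->
  \sum_(a < d) z ^+ (a * n) = (d %| n)%N%:R * d%:R.
Proof.
move=> hz; case: (boolP (d %| n)%N) => hd.
  rewrite mul1r (eq_bigr (fun=> 1)) ?sumr_const ?card_ord // => a _.
  by apply/eqP; rewrite -(prim_order_dvd hz) dvdn_mull.
rewrite mul0r; have hn : z ^+ n != 1 by rewrite -(prim_order_dvd hz).
have : (z ^+ n - 1) * (\sum_(a < d) (z ^+ n) ^+ a) = 0.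
  by rewrite -subrX1 -exprM mulnC exprM (prim_expr_order hz) expr1n subrr.
move/eqP; rewrite mulf_eq0 subr_eq0 (negbTE hn) /= => /eqP h.
by rewrite -[RHS]h; apply: eq_bigr => a _; rewrite mulnC exprM.
Qed.

(** This contraction factor is [(g - e^2 / 4) / g] for the separation [e = 1 / (2 g^4)] of
    [window_exists]. *)
Lemma contraction_ge0 (F : numFieldType) g : (1 < g)%N -> 0 <= 1 - (16 * g%:R ^+ 9)^-1 :> F.
Proof.
move=> g1; have gp : (0 < g)%N by lia.
rewrite subr_ge0 invf_le1 ?mulr_gt0 ?exprn_gt0 ?ltr0n // -natrX -natrM (ler_nat _ 1).
by rewrite muln_gt0 expn_gt0; lia.
Qed.

(** Detect divisibility by the characters [z ^ a] of the integers modulo [d]. The term [a = 0] is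
    the main term; every other one is a product over digit positions, in which each window of length
    [K + 2] loses a fixed factor. *)
Lemma dvd_count_equidistributed_algC g N d x K W : (1 < g)%N -> odd d -> coprime d g ->
  (d%:R : algC) <= (3 / 2) ^+ K -> (K.+2 * W <= N.-1)%N ->
  `|(dvd_count g N d x)%:R / g%:R ^+ N.-1 - d%:R^-1| <= (1 - (16 * g%:R ^+ 9)^-1) ^+ W :> algC.
Proof.
move=> g1 od cdg hK hW.
have d0 : (0 < d)%N by case: d od {cdg hK}.
have [z hz] := C_prim_root_exists d0.
have gp : (0 < g)%N by lia.
have g0 : 0 < g%:R :> algC by rewrite ltr0n.
have gn0 : g%:R != 0 :> algC by rewrite lt0r_neq0.
set q := 1 - (16 * g%:R ^+ 9)^-1; set s := [seq pal_weight g (2 * N) i | i <- iota 1 N.-1].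
have q0 : 0 <= q by apply: contraction_ge0.
pose T (a : nat) : algC := z ^+ (a * x) * \prod_(y <- s) \sum_(k < g) ((z ^+ a) ^+ y) ^+ k.
have hT : (dvd_count g N d x)%:R * d%:R = \sum_(a < d) T a.
  rewrite /dvd_count natr_sum mulr_suml.
  under eq_bigr => v _ do rewrite -(sum_root_unity _ _ _ hz).
  rewrite exchange_big /=; apply: eq_bigr => a _.
  rewrite /T -sum_expr_digit_sums mulr_sumr; apply: eq_bigr => v _.
  by rewrite mulnDr exprD -exprM.
have T0 : T 0%N = g%:R ^+ N.-1.
  rewrite /T mul0n expr0 mul1r (eq_bigr (fun=> g%:R)); last first.
    by move=> y _; rewrite (eq_bigr (fun=> 1)) ?sumr_const ?card_ord // => k _; rewrite !expr1n.
  by rewrite big_const_seq count_predT size_map size_iota iter_mulr_1.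
have Ta a : (0 < a < d)%N -> `|T a| <= g%:R ^+ N.-1 * q ^+ W.
  move=> /andP[a0 ad].
  have wd : (z ^+ a) ^+ d = 1 by rewrite -exprM mulnC exprM (prim_expr_order hz) expr1n.
  have wn1 : z ^+ a != 1 by rewrite -(prim_order_dvd hz) gtnNdvd.
  have w1 : `|z ^+ a| = 1 by apply: norm_root1 d0 wd.
  have z1 : `|z| = 1 by apply: norm_root1 d0 (prim_expr_order hz).
  rewrite /T normrM normrX z1 expr1n mul1r normr_prod big_map.
  pose f i := `|\sum_(k < g) ((z ^+ a) ^+ pal_weight g (2 * N) i) ^+ k| / g%:R.
  have -> : \prod_(i <- iota 1 N.-1) `|\sum_(k < g) ((z ^+ a) ^+ pal_weight g (2 * N) i) ^+ k|
     = g%:R ^+ N.-1 * \prod_(i <- iota 1 N.-1) f i.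
    by rewrite /f big_split /= big_const_seq count_predT size_iota iter_mulr_1 mulrCA -exprMn divff // expr1n mulr1.
  rewrite ler_wpM2l ?exprn_ge0 ?(ltW g0) //.
  apply: (prod_windows _ f q K.+2 W) => //.
    move=> i; rewrite /f divr_ge0 ?(ltW g0) //= ler_pdivrMr // mul1r.
    apply: le_trans (ler_norm_sum _ _ _) _.
    rewrite (eq_bigr (fun=> 1)) ?sumr_const ?card_ord // => k _.
    by rewrite !normrX z1 !expr1n.
  move=> i0 h1 h2.
  have [|i hi he] := window_exists (z ^+ a) g d N i0 K g1 od cdg wd wn1 hK; first lia.
  exists i => //; rewrite /f ler_pdivrMr //.
  apply: le_trans (norm_geom_le _ _ _ g1 _ _ _ he) _.
  - by rewrite normrX w1 expr1n.
  - by rewrite invr_ge0 mulr_ge0 ?exprn_ge0 ?ler0n.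
  - rewrite invf_le1 ?mulr_gt0 ?exprn_gt0 ?ltr0n // -natrX -natrM (ler_nat _ 1).
    by rewrite muln_gt0 expn_gt0; lia.
  by rewrite le_eqVlt /q; apply/orP; left; apply/eqP; field.
have : `|(dvd_count g N d x)%:R * d%:R - g%:R ^+ N.-1| <= d%:R * (g%:R ^+ N.-1 * q ^+ W).
  rewrite hT; case: d d0 od cdg hK hz hT Ta => [//|d] _ _ _ _ _ _ Ta.
  rewrite big_ord_recl T0 addrAC subrr add0r.
  apply: le_trans (ler_norm_sum _ _ _) _.
  apply: (@le_trans _ _ (\sum_(i < d) (g%:R ^+ N.-1 * q ^+ W))).
    by apply: ler_sum => i _; apply: Ta; rewrite lift0 /= ltnS ltn_ord.
  rewrite sumr_const card_ord -[leLHS]mulr_natl ler_wpM2r ?ler_nat //.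
  by rewrite mulr_ge0 ?exprn_ge0 ?(ltW g0).
have dn0 : d%:R != 0 :> algC by rewrite pnatr_eq0 -lt0n.
have -> : (dvd_count g N d x)%:R * d%:R - g%:R ^+ N.-1 =
  ((dvd_count g N d x)%:R / g%:R ^+ N.-1 - d%:R^-1) * (d%:R * g%:R ^+ N.-1) :> algC.
  by field; rewrite dn0 expf_neq0.
rewrite normrM [X in _ * X <= _]ger0_norm ?mulr_ge0 ?exprn_ge0 ?ler0n ?(ltW g0) //.
by rewrite mulrA [_ * q ^+ _]mulrC ler_pM2r // mulr_gt0 ?exprn_gt0 ?ltr0n.
Qed.

(** Both sides are rational numbers, so the inequality descends from [algC] to the rationals and
    embeds into [R]. *)
Lemma dvd_count_equidistributed (R : realFieldType) g N d x K W : (1 < g)%N -> odd d -> coprime d g ->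
  d%:R <= (3 / 2) ^+ K :> R -> (K.+2 * W <= N.-1)%N ->
  `|(dvd_count g N d x)%:R / g%:R ^+ N.-1 - d%:R^-1| <= (1 - (16 * g%:R ^+ 9)^-1) ^+ W :> R.
Proof.
move=> g1 od cdg hK hW.
have e1 (F : numFieldType) : d%:R = ratr d%:R :> F by rewrite ratr_nat.
have e2 (F : numFieldType) : (3 / 2) ^+ K = ratr ((3 / 2) ^+ K) :> F.
  by rewrite rmorphXn /= fmorph_div /= !ratr_nat.
have e3 (F : numFieldType) : (1 - (16 * g%:R ^+ 9)^-1) ^+ W = ratr ((1 - (16 * g%:R ^+ 9)^-1) ^+ W) :> F.
  by rewrite rmorphXn rmorphB rmorph1 fmorphV rmorphM rmorphXn /= !ratr_nat.
have e4 (F : numFieldType) : `|(dvd_count g N d x)%:R / g%:R ^+ N.-1 - d%:R^-1| =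
    ratr `|(dvd_count g N d x)%:R / g%:R ^+ N.-1 - d%:R^-1| :> F.
  by rewrite ratr_norm rmorphB fmorph_div fmorphV rmorphXn /= !ratr_nat.
rewrite e3 e4 ler_rat -(ler_rat algC) -e3 -e4; apply: (@dvd_count_equidistributed_algC _ _ _ _ K) => //.
by rewrite e1 e2 ler_rat -(ler_rat R) -e1 -e2.
Qed.

(** * Moebius sums *)

(** For distinct primes [ps], the sum of [mu d * f d] over the divisors [d] of their product. *)
Fixpoint moebius_sum (F : zmodType) (ps : seq nat) (f : nat -> F) : F :=
  if ps is p :: ps' then moebius_sum F ps' f - moebius_sum F ps' (fun d => f (p * d)%N) else f 1%N.
Arguments moebius_sum {F}.

Lemma eq_moebius_sum (F : zmodType) ps (f h : nat -> F) : f =1 h -> moebius_sum ps f = moebius_sum ps h.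
Proof.
by elim: ps f h => [|p ps IH] f h e /=; rewrite ?e // (IH f h) // (IH (fun d => f (p * d)%N) (fun d => h (p * d)%N)).
Qed.

Lemma moebius_sum_sum (F : zmodType) (I : Type) (s : seq I) ps (f : I -> nat -> F) :
  moebius_sum ps (fun d => \sum_(i <- s) f i d) = \sum_(i <- s) moebius_sum ps (f i).
Proof.
elim: ps f => [|p ps IH] f //=.
by rewrite (IH f) (IH (fun i d => f i (p * d)%N)) sumrB.
Qed.

Lemma moebius_sumB (F : zmodType) ps (f h : nat -> F) : moebius_sum ps f - moebius_sum ps h = moebius_sum ps (fun d => f d - h d).
Proof.
elim: ps f h => [|p ps IH] f h //=; rewrite -IH -(IH (fun d => f (p * d)%N)).
by rewrite !opprB [X in _ + X = _]addrC addrACA [X in _ = _ + X]addrC.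
Qed.

Lemma norm_moebius_sum_le (F : numDomainType) ps (f : nat -> F) : `|moebius_sum ps f| <= \sum_(d <- sqfree_prods ps) `|f d|.
Proof.
elim: ps f => [|p ps IH] f /=; first by rewrite big_seq1.
rewrite big_cat big_map /=; apply: le_trans (ler_normB _ _) _; exact: lerD.
Qed.

Lemma moebius_sumZ (F : pzRingType) ps c (f : nat -> F) : moebius_sum ps (fun d => c * f d) = c * moebius_sum ps f.
Proof.
by elim: ps f => [|p ps IH] f //=; rewrite (IH f) (IH (fun d => f (p * d)%N)) mulrBr.
Qed.

Lemma moebius_sum_multiplicative (F : pzRingType) ps (f : nat -> F) : f 1%N = 1 ->
  (forall a b, f (a * b)%N = f a * f b) -> moebius_sum ps f = \prod_(p <- ps) (1 - f p).
Proof.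
move=> f1 fM; elim: ps => [|p ps IH] /=; first by rewrite big_nil.
by rewrite big_cons (eq_moebius_sum _ _ _ _ (fM p)) moebius_sumZ IH mulrBl mul1r.
Qed.

Lemma eq_in_moebius_sum (F : zmodType) ps (f h : nat -> F) : {in sqfree_prods ps, f =1 h} -> moebius_sum ps f = moebius_sum ps h.
Proof.
elim: ps f h => [|p ps IH] f h e /=; first by apply: e; rewrite inE.
congr (_ - _); apply: IH => d hd; apply: e; rewrite mem_cat ?hd //.
by apply/orP; right; apply/mapP; exists d.
Qed.

(** Inclusion-exclusion one prime at a time: products of the other primes are coprime to [p], so the
    terms with [p] cancel the rest if [p] divides [n] and vanish otherwise. *)
Lemma moebius_sum_dvd (F : pzRingType) ps n : distinct_primes ps ->
  moebius_sum ps (fun d => (d %| n)%N%:R) = (~~ has (fun p => p %| n)%N ps)%:R :> F.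
Proof.
elim: ps => [|p ps IH] /=; first by rewrite dvd1n.
move=> /distinct_primes_cons[pp hps hc].
rewrite (eq_in_moebius_sum _ _ (fun d => (p * d %| n)%N%:R) (fun d => (p %| n)%N%:R * (d %| n)%N%:R)).
  by rewrite moebius_sumZ IH //; case: (p %| n)%N; rewrite ?mul1r ?subrr ?mul0r ?subr0.
move=> d /(allP (sqfree_prods_coprime _ _ hc)); rewrite coprime_sym => cpd.
by rewrite Gauss_dvd // -natrM mulnb.
Qed.

Lemma count_coprime_pairs (F : pzRingType) ps g N x y : distinct_primes ps ->
  let V := digit_sums g [seq pal_weight g (2 * N) i | i <- iota 1 N.-1] in
  \sum_(v <- V) \sum_(v' <- V) (~~ has (fun p => p %| gcdn (x + v) (y + v'))%N ps)%:R
   = moebius_sum ps (fun d => (dvd_count g N d x)%:R * (dvd_count g N d y)%:R) :> F.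
Proof.
move=> hps V.
under eq_bigr => v _ do under eq_bigr => v' _ do rewrite -moebius_sum_dvd //.
under eq_bigr => v _ do rewrite -moebius_sum_sum.
rewrite -moebius_sum_sum; apply: eq_moebius_sum => d.
rewrite /dvd_count !natr_sum mulr_suml; apply: eq_bigr => v _.
rewrite mulr_sumr; apply: eq_bigr => v' _.
by rewrite dvdn_gcd -natrM mulnb.
Qed.

(** Telescoping, from [1 / (m + 1)^2 <= 1 / m - 1 / (m + 1)]. *)
Lemma sum_inv_sq_iota (F : realFieldType) X n : (0 < X)%N ->
  \sum_(d <- iota X.+1 n) (d%:R ^+ 2)^-1 <= X%:R^-1 - (X + n)%:R^-1 :> F.
Proof.
move=> X0; elim: n => [|n IH]; first by rewrite big_nil addn0 subrr.
rewrite -[in iota _ _](addn1 n) iotaD big_cat /= big_seq1.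
apply: le_trans (lerD IH (lexx _)) _; rewrite -addrA lerD2l.
rewrite addnS addSn; set m := (X + n)%N.
have m0 : 0 < m%:R :> F by rewrite ltr0n /m; lia.
rewrite -natr1; set z : F := m%:R in m0 *.
have -> : - z^-1 + ((z + 1) ^+ 2)^-1 = - (z + 1)^-1 - (z * (z + 1) ^+ 2)^-1.
  by field; rewrite !lt0r_neq0 // ?addr_gt0.
by rewrite gerDl oppr_le0 invr_ge0 mulr_ge0 ?exprn_ge0 ?addr_ge0 // ltW.
Qed.

Lemma sum_inv_sq_le (F : realFieldType) s X : (0 < X)%N -> uniq s -> all (fun d => X < d)%N s ->
  \sum_(d <- s) (d%:R ^+ 2)^-1 <= X%:R^-1 :> F.
Proof.
move=> X0 us hs; set n := (\max_(d <- s) d)%N.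
have sn d : d \in s -> (d <= n)%N.
  by move=> hd; rewrite /n (big_rem d hd) /= leq_maxl.
have ps : perm_eq s (seq.filter (fun d => d \in s) (iota X.+1 n)).
  apply: uniq_perm => //; first by rewrite filter_uniq // iota_uniq.
  move=> d; rewrite mem_filter mem_iota; case: (boolP (d \in s)) => //= hd.
  by have := sn _ hd; have := allP hs _ hd; lia.
rewrite (perm_big _ ps) big_filter /=; apply: le_trans (_ : _ <= \sum_(d <- iota X.+1 n) (d%:R ^+ 2)^-1) _.
  by rewrite big_mkcond ler_sum // => d _; case: ifP => // _; rewrite invr_ge0 exprn_ge0.
apply: le_trans (sum_inv_sq_iota _ _ _ X0) _.
by rewrite gerBl invr_ge0.
Qed.

(** * Residue densities: small and large moduli combined *)

Lemma bernoulli_ineq (F : realFieldType) (x : F) n : 0 <= x -> 1 + n%:R * x <= (1 + x) ^+ n.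
Proof.
move=> x0; elim: n => [|n IH]; first by rewrite mul0r addr0.
rewrite exprS; apply: (@le_trans _ _ ((1 + x) * (1 + n%:R * x))); last by rewrite ler_wpM2l // addr_ge0.
rewrite -natr1; have : 0 <= x * (n%:R * x) by rewrite !mulr_ge0.
lra.
Qed.

(** For [z = 1 / (16 g^9)], [(1 - z)(1 + z) <= 1] and Bernoulli bound the power by [1 / (1 + A z)];
    [A] is chosen with [A z = g^5]. *)
Lemma contraction_exponent (F : realFieldType) g : (1 < g)%N ->
  exists2 A, (0 < A)%N & (1 - (16 * g%:R ^+ 9)^-1) ^+ A <= (g%:R ^+ 5)^-1 :> F.
Proof.
move=> g1; have gp : (0 < g)%N by lia.
exists (16 * g ^ 9 * g ^ 5)%N; first by rewrite muln_gt0 muln_gt0 !expn_gt0 gp.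
have g0 : 0 < g%:R :> F by rewrite ltr0n.
have q0 := contraction_ge0 F g g1.
set h : F := 16 * g%:R ^+ 9 in q0 *; set A := (_ * _)%N.
have h0 : 0 < h by rewrite mulr_gt0 ?exprn_gt0 ?ltr0n.
have hA : A%:R = h * g%:R ^+ 5 by rewrite /A natrM natrM !natrX.
have i0 : 0 < h^-1 by rewrite invr_gt0.
have := bernoulli_ineq F h^-1 A (ltW i0).
rewrite hA mulrAC divff ?lt0r_neq0 // mul1r => hb.
have hq : (1 - h^-1) ^+ A * (1 + h^-1) ^+ A <= 1.
  rewrite -exprMn exprn_ile1 //; last first.
    have : 0 <= h^-1 * h^-1 by rewrite mulr_ge0 // ltW.
    by set z := h^-1; lra.
  by rewrite mulr_ge0 // addr_ge0 // ltW.
rewrite -[leRHS]div1r ler_pdivlMr ?exprn_gt0 //; apply: le_trans hq.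
apply: ler_wpM2l; first exact: exprn_ge0.
apply: le_trans hb; by rewrite lerDr.
Qed.

Definition density (F : realFieldType) g N d x : F := (dvd_count g N d x)%:R / g%:R ^+ N.-1.

Lemma density_ge0 (F : realFieldType) g N d x : 0 <= density F g N d x.
Proof. by rewrite divr_ge0 ?exprn_ge0. Qed.

Lemma density_le1 (F : realFieldType) g N d x : (1 < g)%N -> density F g N d x <= 1.
Proof.
move=> g1; have gp : (0 < g)%N by lia.
rewrite ler_pdivrMr ?exprn_gt0 ?ltr0n // mul1r -natrX ler_nat /dvd_count -[leqRHS]muln1.
have -> : (g ^ N.-1 * 1 = \sum_(v <- digit_sums g [seq pal_weight g (2 * N) i | i <- iota 1 N.-1]) 1)%N.
  by rewrite sum1_size size_digit_sums size_map size_iota muln1.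
by apply: leq_sum => v _; case: (_ %| _)%N.
Qed.

Lemma density_equidistributed (F : realFieldType) g : (1 < g)%N -> exists B, forall N d x T,
  odd d -> coprime d g -> (0 < T)%N -> (B * T ^ 2 <= N)%N -> (d <= g ^ (4 * T))%N ->
  `|density F g N d x - d%:R^-1| <= (g%:R ^+ (5 * T))^-1.
Proof.
move=> g1; have [A A0 hA] := contraction_exponent F g g1.
exists (10 * g * A + 1)%N => N d x T od cdg T0 hN hd.
have gp : (0 < g)%N by lia.
have g0 : 0 < g%:R :> F by rewrite ltr0n.
apply: le_trans (_ : _ <= (1 - (16 * g%:R ^+ 9)^-1) ^+ (A * T)) _.
  (* Since [(3/2)^2 > 2] and [2 ^ g > g], [(3/2) ^ (8 g T)] exceeds [g ^ (4T) >= d]. The [A T]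
     windows of length [8 g T + 2] take at most [10 g A T^2] positions; the [+ 1] in the witness
     covers the passage from [N] to [N - 1]. *)
  apply: (@dvd_count_equidistributed _ _ _ _ _ (8 * g * T)) => //; last first.
    have h1 : (A * T <= g * A * T ^ 2)%N by rewrite -mulnA (leq_trans _ (leq_pmull _ gp)) // leq_mul2l expnS expn1 leq_pmulr ?orbT.
    have h2 : (0 < T ^ 2)%N by rewrite expn_gt0 T0.
    have -> : ((8 * g * T).+2 * (A * T) = 8 * (g * A * T ^ 2) + 2 * (A * T))%N by rewrite -addn2; ring.
    have e3 : ((10 * g * A + 1) * T ^ 2 = 10 * (g * A * T ^ 2) + T ^ 2)%N by ring.
    by rewrite e3 in hN; lia.
  have -> : (8 * g * T = (2 * g) * (4 * T))%N by ring.
  apply: (@le_trans _ _ ((g%:R) ^+ (4 * T))); first by rewrite -natrX ler_nat.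
  rewrite [leRHS]exprM lerXn2r ?nnegrE ?exprn_ge0 ?divr_ge0 //.
  apply: (@le_trans _ _ (2 ^+ g)); first by rewrite -natrX ler_nat ltnW // ltn_expl.
  by rewrite exprM lerXn2r ?nnegrE ?exprn_ge0 ?divr_ge0 //; lra.
rewrite exprM [(g%:R ^+ (5 * T))]exprM -exprVn lerXn2r ?nnegrE ?exprn_ge0 ?invr_ge0 ?exprn_ge0 //.
exact: contraction_ge0.
Qed.

(** The ranges [g ^ (4k) < d <= g ^ (4k + 4)] are peeled off until [6 (k + 1) > N], where
    [sum_dvd_count_sq_large] takes all that remains. The bounds shrink by [g >= 2] at each step, so
    doubling the constant absorbs the series. *)
Lemma sum_density_sq_tail (F : realFieldType) g : (1 < g)%N -> exists2 C : F, 0 <= C & forall ps N k x,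
  distinct_primes ps -> all (fun p => coprime p g) ps -> (0 < k)%N -> (6 * k <= N)%N ->
  (0 < x)%N -> (x <= g ^ (2 * N + 1))%N ->
  \sum_(d <- sqfree_prods ps | (g ^ (4 * k) < d)%N) density F g N d x ^+ 2 <= C / g%:R ^+ k.
Proof.
move=> g1; have [C1 h1] := sum_dvd_count_sq_block g g1; have [C2 h2] := sum_dvd_count_sq_large g g1.
have g0 : 0 < g%:R :> F by rewrite ltr0n; lia.
set C : F := C1%:R + C2%:R.
have C0 : 0 <= C by rewrite addr_ge0.
have cv ps N k x (P : pred nat) (c : nat) : (c%:R <= C) ->
   ((\sum_(d <- sqfree_prods ps | P d) dvd_count g N d x ^ 2) * g ^ k <= c * g ^ (2 * N.-1))%N ->
   \sum_(d <- sqfree_prods ps | P d) density F g N d x ^+ 2 <= C / g%:R ^+ k.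
  move=> hc; rewrite -(ler_nat F) !natrM natr_sum !natrX => h.
  rewrite ler_pdivlMr ?exprn_gt0 //; apply: le_trans hc.
  rewrite -(@ler_pM2r _ (g%:R ^+ (2 * N.-1))) ?exprn_gt0 //.
  apply: le_trans h; rewrite mulrAC ler_wpM2r ?exprn_ge0 // ?(ltW g0) //.
  rewrite mulr_suml le_eqVlt; apply/orP; left; apply/eqP; apply: eq_bigr => d _.
  rewrite /density natrX exprMn exprVn -exprM [(N.-1 * 2)%N]mulnC -mulrA mulVf ?mulr1 //.
  by rewrite expf_neq0 // lt0r_neq0.
exists (2 * C); first by rewrite mulr_ge0.
move=> ps N k x hps cps k0 kN x0 hx.
have [m hm] : exists m, (m = N %/ 6 - k)%N by eexists.
elim: m k k0 kN hm => [|m IH] k k0 kN hm.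
  have Nk : (N < 6 * k + 6)%N by lia.
  apply: le_trans (cv _ _ _ _ _ _ _ (h2 ps N k x hps cps k0 kN Nk x0 hx)) _; first by rewrite lerDr.
  by rewrite ler_wpM2r ?invr_ge0 ?exprn_ge0 ?(ltW g0) //; lra.
have kN' : (6 * k.+1 <= N)%N by lia.
rewrite (bigID (fun d => d <= g ^ (4 * k + 4))%N) /=.
have b1 : \sum_(d <- sqfree_prods ps | (g ^ (4 * k) < d)%N && (d <= g ^ (4 * k + 4))%N) density F g N d x ^+ 2 <= C / g%:R ^+ k.
  by apply: cv (h1 ps N k x hps cps k0 kN); rewrite lerDl.
have b2 : \sum_(d <- sqfree_prods ps | (g ^ (4 * k) < d)%N && ~~ (d <= g ^ (4 * k + 4))%N) density F g N d x ^+ 2 <= (2 * C) / g%:R ^+ k.+1.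
  apply: le_trans (IH k.+1 _ _ _); [|lia..].
  rewrite le_eqVlt; apply/orP; left; apply/eqP; apply: eq_bigl => d.
  rewrite -ltnNge; have -> : (4 * k.+1 = 4 * k + 4)%N by lia.
  case: (ltnP (g ^ (4 * k + 4)) d) => h; rewrite ?andbF // andbT.
  by apply: leq_ltn_trans h; rewrite leq_pexp2l //; lia.
apply: le_trans (lerD b1 b2) _.
rewrite exprS invfM mulrA; set e := (g%:R ^+ k)^-1.
have e0 : 0 <= e by rewrite invr_ge0 exprn_ge0 // ltW.
rewrite -mulrDl ler_wpM2r //.
have : 2 * C / g%:R <= C.
  rewrite ler_pdivrMr // mulrC ler_wpM2l // (ler_nat _ 2 g) //.
lra.
Qed.

(** At most [g ^ (4T)] moduli are small, each with error at most [2 / g ^ (5T)]. For the large ones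
    the product of two densities is at most the sum of their squares, which leaves two density tails
    and the tail of [1 / d^2]. *)
Lemma density_pairs (F : realFieldType) g : (1 < g)%N -> exists B (C : F), [/\ (6 <= B)%N, 0 <= C & forall ps N T x y,
  distinct_primes ps -> all (fun p => coprime p g) ps -> all (fun p => coprime p 2) ps ->
  (0 < T)%N -> (B * T ^ 2 <= N)%N ->
  (0 < x)%N -> (x <= g ^ (2 * N + 1))%N -> (0 < y)%N -> (y <= g ^ (2 * N + 1))%N ->
  `|moebius_sum ps (fun d => density F g N d x * density F g N d y) - \prod_(p <- ps) (1 - (p%:R ^+ 2)^-1)|
    <= C / g%:R ^+ T].
Proof.
move=> g1; have [B0 hB] := density_equidistributed F g g1; have [C C0 hC] := sum_density_sq_tail F g g1.
(* The summand 6 guarantees [6T <= N], as the tail estimate requires. *)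
exists (B0 + 6)%N, (2 + (2 * C + 1)); split; [by rewrite leq_addl|by rewrite !addr_ge0 ?mulr_ge0|].
move=> ps N T x y hps cps ops T0 hN x0 hx y0 hy.
have gp : (0 < g)%N by lia.
have g0 : 0 < g%:R :> F by rewrite ltr0n.
rewrite -(moebius_sum_multiplicative _ _ (fun d => (d%:R ^+ 2)^-1)); last 2 first.
- by rewrite expr1n invr1.
- by move=> a b; rewrite natrM exprMn invfM.
rewrite moebius_sumB; apply: le_trans (norm_moebius_sum_le _ _ _) _.
rewrite (bigID (fun d => d <= g ^ (4 * T))%N) /= mulrDl lerD //.
  apply: (@le_trans _ _ (\sum_(d <- sqfree_prods ps | (d <= g ^ (4 * T))%N) (2 / g%:R ^+ (5 * T)))).
    rewrite big_seq_cond [leRHS]big_seq_cond; apply: ler_sum => d /andP[hd hd2].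
    have od : odd d by have := allP (sqfree_prods_coprime _ _ ops) d hd; rewrite coprimen2.
    have cd : coprime d g := allP (sqfree_prods_coprime _ _ cps) d hd.
    have d0 : (0 < d)%N by case: (d) od.
    have e1 := hB N d x T od cd T0 _ hd2; have e2 := hB N d y T od cd T0 _ hd2.
    have -> : density F g N d x * density F g N d y - (d%:R ^+ 2)^-1 =
      (density F g N d x - d%:R^-1) * density F g N d y + d%:R^-1 * (density F g N d y - d%:R^-1).
      rewrite expr2 invfM; ring.
    apply: le_trans (ler_normD _ _) _; rewrite (normrM (density F g N d x - _)) (normrM d%:R^-1).
    have hN0 : (B0 * T ^ 2 <= N)%N by nia.
    rewrite [X in _ * X + _]ger0_norm ?density_ge0 // [`|d%:R^-1|]ger0_norm ?invr_ge0 //.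
    set e := (g%:R ^+ (5 * T))^-1 in e1 e2 *.
    have -> : 2 * e = e * 1 + 1 * e by ring.
    apply: lerD; apply: ler_pM => //; rewrite ?density_ge0 ?density_le1 ?e1 ?e2 ?invr_ge0 //.
    by rewrite invf_le1 ?ltr0n // (ler_nat _ 1).
  rewrite big_const_seq iter_addr_0 -[leLHS]mulr_natr -mulrA ler_wpM2l //.
  rewrite mulrC ler_pdivrMr ?exprn_gt0 // mulrC.
  have -> : (5 * T = T + 4 * T)%N by lia.
  rewrite exprD mulrAC divff ?mul1r ?expf_neq0 ?lt0r_neq0 // -natrX ler_nat.
  rewrite -size_filter -[leqRHS](size_iota 1) uniq_leq_size ?filter_uniq ?uniq_sqfree_prods //.
  move=> d; rewrite mem_filter mem_iota => /andP[h1 h2].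
  have := allP (sqfree_prods_coprime _ _ ops) d h2; rewrite coprimen2 => /odd_gt0 d0.
  by rewrite d0 add1n ltnS.
have hN6 : (6 * T <= N)%N by nia.
have t1 := hC ps N T x hps cps T0 hN6 x0 hx.
have t2 := hC ps N T y hps cps T0 hN6 y0 hy.
have t3 : \sum_(d <- sqfree_prods ps | (g ^ (4 * T) < d)%N) (d%:R ^+ 2)^-1 <= 1 / g%:R ^+ T :> F.
  rewrite -big_filter; apply: le_trans (sum_inv_sq_le _ _ (g ^ (4 * T)) _ _ _) _.
  - by rewrite expn_gt0 gp.
  - by rewrite filter_uniq ?uniq_sqfree_prods.
  - by apply/allP => d; rewrite mem_filter => /andP[].
  rewrite div1r lef_pV2 ?posrE ?exprn_gt0 ?ltr0n ?expn_gt0 ?gp //.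
  by rewrite -natrX ler_nat leq_pexp2l //; lia.
apply: le_trans (_ : _ <= \sum_(d <- sqfree_prods ps | (g ^ (4 * T) < d)%N)
   (density F g N d x ^+ 2 + density F g N d y ^+ 2 + (d%:R ^+ 2)^-1)) _.
  rewrite (eq_bigl (fun d => (g ^ (4 * T) < d)%N)); last by move=> d; rewrite -ltnNge.
  apply: ler_sum => d _; apply: le_trans (ler_normB _ _) _.
  rewrite [`|_^-1|]ger0_norm ?invr_ge0 ?exprn_ge0 // lerD2r.
  rewrite ger0_norm; last by apply: mulr_ge0; apply: density_ge0.
  by have := density_ge0 F g N d x; have := density_ge0 F g N d y; nra.
rewrite !big_split /= mulrDl lerD // [2 * C]mulr_natl mulr2n mulrDl lerD //.
Qed.

(** * The Euler product of zeta(2) *)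

Lemma zeta2_partial (R : realType) n : (0 < n)%N ->
  \sum_(d <- iota 1 n) (d%:R ^+ 2)^-1 <= zeta (2 : R) <= \sum_(d <- iota 1 n) (d%:R ^+ 2)^-1 + n%:R^-1.
Proof.
move=> n0; rewrite /zeta.
set u : nat -> R := fun k : nat => (k.+1%:R `^ 2)^-1.
have hu m : series u m = \sum_(d <- iota 1 m) (d%:R ^+ 2)^-1.
  rewrite /series /= /index_iota subn0 -[1%N]addn0 iotaDl big_map; apply: eq_bigr => k _.
  by rewrite /u add1n powR_mulrn // ler0n.
have nd : nondecreasing_seq (series u).
  apply/nondecreasing_seqP => m; rewrite !hu -[in iota _ m.+1](addn1 m) iotaD big_cat /= big_seq1.
  by rewrite lerDl invr_ge0 exprn_ge0.
have le m : series u m <= series u n + n%:R^-1.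
  apply: le_trans (_ : _ <= series u (n + m)%N) _; first by apply: nd; rewrite leq_addl.
  rewrite !hu iotaD big_cat /= lerD2l add1n.
  by apply: le_trans (sum_inv_sq_iota _ _ _ n0) _; rewrite gerBl invr_ge0.
have cu : cvgn (series u).
  apply: nondecreasing_is_cvgn => //; exists (series u n + n%:R^-1) => _ [m _ <-]; exact: le.
apply/andP; split; first by rewrite -hu; apply: nondecreasing_cvgn_le.
by rewrite -hu; apply: limr_le => //; apply: nearW.
Qed.

Lemma sum_dvd_iota (F : nmodType) d m (f : nat -> F) : (0 < d)%N ->
  \sum_(n <- iota 1 (d * m) | (d %| n)%N) f n = \sum_(k <- iota 1 m) f (d * k)%N.
Proof.
move=> d0; rewrite -big_filter -[RHS](big_map (muln d) xpredT f); apply: perm_big.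
apply: uniq_perm; first by rewrite filter_uniq ?iota_uniq.
  by rewrite map_inj_uniq ?iota_uniq // => a b /eqP; rewrite eqn_pmul2l // => /eqP.
move=> n; rewrite mem_filter mem_iota; apply/idP/mapP.
  move=> /andP[/dvdnP[k ->]]; rewrite mulnC add1n ltnS muln_gt0 d0 /= leq_pmul2l // => hk.
  by exists k; rewrite ?mem_iota ?add1n ?ltnS.
move=> [k]; rewrite mem_iota add1n ltnS => /andP[k0 km] ->.
by rewrite dvdn_mulr //= muln_gt0 d0 k0 add1n ltnS leq_pmul2l.
Qed.

Lemma sqfree_prods_dvd_prod ps d : d \in sqfree_prods ps -> (d %| \prod_(p <- ps) p)%N.
Proof.
elim: ps d => [|p ps IH] d /=; first by rewrite inE => /eqP ->; rewrite dvd1n.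
rewrite big_cons mem_cat => /orP[/IH|/mapP[e /IH he ->]]; first exact: dvdn_mull.
exact: dvdn_mul.
Qed.

(** Compute [A], the sum of [1 / n^2] over [n] free of primes in [ps], in two ways. Besides [n = 1]
    only [n > M] occur, so [A] is within [1/M] of 1. By Moebius inversion [A] is also a combination
    of partial sums of [zeta 2], each within [1/M] of the limit and weighted by [1 / d^2]. *)
Lemma zeta2_euler (R : realType) ps M : (0 < M)%N -> distinct_primes ps ->
  (forall p, prime p -> (p <= M)%N -> p \in ps) ->
  `|zeta (2 : R) * \prod_(p <- ps) (1 - (p%:R ^+ 2)^-1) - 1| <= 3 / M%:R.
Proof.
move=> M0 hps hM.
have ps0 : all (ltn 0) ps by apply/allP => p hp; apply: prime_gt0; apply: (allP (andP hps).2).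
set Q := (\prod_(p <- ps) p)%N.
have Q0 : (0 < Q)%N.
  rewrite /Q; elim: (ps) ps0 => [|p q IH] /=; first by rewrite big_nil.
  by move=> /andP[p0 /IH h]; rewrite big_cons muln_gt0 p0.
pose f n : R := (n%:R ^+ 2)^-1.
have f0 n : 0 <= f n by rewrite invr_ge0 exprn_ge0.
have M0' : 0 < M%:R :> R by rewrite ltr0n.
(* With the cutoff [Q * M] every [d] dividing [Q] divides the length of the range, and the range
   divided by [d] still has at least [M] terms. *)
set A := \sum_(n <- iota 1 (Q * M)) (~~ has (fun p => (p %| n)%N) ps)%:R * f n.
have A1 : `|A - 1| <= M%:R^-1.
  have -> : A = 1 + \sum_(n <- iota 2 (Q * M).-1 | ~~ has (fun p => (p %| n)%N) ps) f n.
    rewrite /A; have -> : iota 1 (Q * M) = 1%N :: iota 2 (Q * M).-1 by case: (Q * M)%N (muln_gt0 Q M); rewrite Q0 M0.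
    rewrite big_cons; congr (_ + _).
      rewrite /f expr1n invr1 mulr1; suff -> : has (fun p => (p %| 1)%N) ps = false by [].
      apply/hasPn => p hp; rewrite dvdn1; apply: contraTneq (allP (andP hps).2 p hp) => ->; exact: isT.
    rewrite [RHS]big_mkcond; apply: eq_bigr => n _; case: ifP => _; by rewrite ?mul1r ?mul0r.
  rewrite addrAC subrr add0r ger0_norm ?sumr_ge0 // -big_filter.
  apply: sum_inv_sq_le => //; first by rewrite filter_uniq ?iota_uniq.
  apply/allP => n; rewrite mem_filter mem_iota => /andP[/hasPn hn /andP[n2 _]].
  rewrite ltnNge; apply/negP => nM.
  have pn := pdiv_prime n2.
  have := hn (pdiv n); rewrite pdiv_dvd => /(_ _)/negP; apply => //.
  apply: hM => //; apply: leq_trans nM; apply: pdiv_leq; lia.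
have Ae : A = moebius_sum ps (fun d => f d * \sum_(k <- iota 1 (Q * M %/ d)) f k).
  rewrite /A; under eq_bigr => n _ do rewrite -(moebius_sum_dvd _ _ _ hps) mulrC -moebius_sumZ.
  rewrite -moebius_sum_sum; apply: eq_in_moebius_sum => d hd.
  have d0 : (0 < d)%N := allP (sqfree_prods_gt0 _ ps0) d hd.
  have dQ : (d %| Q * M)%N by apply: dvdn_mulr; apply: sqfree_prods_dvd_prod.
  rewrite -{1}(divnK dQ) [(_ %/ _ * d)%N]mulnC mulr_sumr.
  rewrite (eq_bigr (fun n => if (d %| n)%N then f n else 0)).
    rewrite -big_mkcond sum_dvd_iota //; apply: eq_bigr => k _.
    by rewrite /f natrM exprMn invfM.
  by move=> n _; case: ifP; rewrite ?mulr1 ?mulr0.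
have -> : \prod_(p <- ps) (1 - (p%:R ^+ 2)^-1) = moebius_sum ps f.
  rewrite moebius_sum_multiplicative // /f ?expr1n ?invr1 //.
  by move=> a b; rewrite natrM exprMn invfM.
rewrite -moebius_sumZ.
apply: le_trans (ler_distD A _ _) _.
have -> : 3 / M%:R = 2 / M%:R + M%:R^-1 :> R by field; rewrite lt0r_neq0.
apply: lerD => //; rewrite Ae moebius_sumB; apply: le_trans (norm_moebius_sum_le _ _ _) _.
apply: (@le_trans _ _ (\sum_(d <- sqfree_prods ps) f d * M%:R^-1)).
  rewrite big_seq [leRHS]big_seq; apply: ler_sum => d hd.
  have d0 : (0 < d)%N := allP (sqfree_prods_gt0 _ ps0) d hd.
  have dQ : (d %| Q)%N by apply: sqfree_prods_dvd_prod.
  rewrite [zeta _ * _]mulrC -mulrBr normrM ger0_norm // ler_wpM2l //.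
  have hm : (M <= Q * M %/ d)%N by rewrite leq_divRL // mulnC leq_mul2r dvdn_leq ?orbT.
  have m0 : (0 < Q * M %/ d)%N by apply: leq_trans M0 hm.
  have /andP[h1 h2] := zeta2_partial R _ m0.
  rewrite ger0_norm ?subr_ge0 //; rewrite -lerBlDl in h2; apply: le_trans h2 _.
  by rewrite lef_pV2 ?posrE ?ltr0n // ler_nat.
rewrite -mulr_suml ler_wpM2r ?invr_ge0 //.
(* The weights [1 / d^2] add up to at most 2: 1 from [d = 1] and at most 1 from all larger [d]. *)
rewrite (bigID (fun d => d == 1%N)) /= [leRHS](_ : 2 = 1 + 1%:R^-1); last by rewrite invr1.
apply: lerD.
  rewrite big_mkcond /= (eq_bigr (fun d => if d == 1%N then 1 else 0)); last first.
    by move=> d _; case: eqP => // ->; rewrite /f expr1n invr1.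
  rewrite -big_mkcond /= big_const_seq iter_addr_0 (ler_nat R _ 1) (count_uniq_mem _ (uniq_sqfree_prods _ hps)).
  by case: (_ \in _).
rewrite -big_filter; apply: sum_inv_sq_le => //; first by rewrite filter_uniq ?uniq_sqfree_prods.
apply/allP => d; rewrite mem_filter => /andP[d1 hd].
have d0 : (0 < d)%N := allP (sqfree_prods_gt0 _ ps0) d hd; lia.
Qed.

Local Open Scope nat_scope.

(** * Palindromes as digit sums *)

Lemma digit_sums_mapP g (w : nat -> nat) r v : uniq r -> 0 < g ->
  v \in digit_sums g [seq w i | i <- r] <-> exists f : nat -> nat, (forall i, f i < g) /\ v = \sum_(i <- r) f i * w i.
Proof.
move=> ur g0; split.
  elim: r ur v => [|i r IH] /= ur v.
    by rewrite inE => /eqP ->; exists (fun=> 0); rewrite big_nil.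
  case/andP: ur => ir ur /allpairsP[[n u] /= [hn /(IH ur)[f [hf ->]] ->]].
  exists (fun j => if j == i then n else f j); split.
    by move=> j; case: ifP => // _; move: hn; rewrite mem_iota.
  rewrite big_cons eqxx; congr (_ + _); rewrite [LHS]big_seq [RHS]big_seq.
  by apply: eq_bigr => j hj; case: eqP => // e; rewrite e (negbTE ir) in hj.
move=> [f [hf ->]]; elim: r {ur} => [|i r IH] /=; first by rewrite big_nil inE.
rewrite big_cons; apply/allpairsP; exists (f i, \sum_(j <- r) f j * w j).
by split => //=; rewrite mem_iota /=.
Qed.

Lemma iota0_cons n : 0 < n -> iota 0 n = 0 :: iota 1 n.-1.
Proof. by case: n. Qed.

Lemma big_palindromic g N (D : nat -> nat) : 0 < N -> (forall i, i <= 2 * N -> D (2 * N - i) = D i) ->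
  \sum_(i < (2 * N).+1) D i * g ^ i =
  D 0 * pal_weight g (2 * N) 0 + (\sum_(i <- iota 1 N.-1) D i * pal_weight g (2 * N) i + D N * g ^ N).
Proof.
move=> N0 hD; rewrite -(big_mkord xpredT (fun i => D i * g ^ i)) /index_iota subn0.
have -> : (2 * N).+1 = N + (1 + N) by lia.
rewrite iotaD big_cat iotaD big_cat /= big_seq1 add0n.
have -> : \sum_(i <- iota (N + 1) N) D i * g ^ i = \sum_(i <- iota 0 N) D i * g ^ (2 * N - i).
  rewrite (perm_big [seq 2 * N - i | i <- iota 0 N]) /=.
    rewrite big_map [LHS]big_seq [RHS]big_seq; apply: eq_bigr => i; rewrite mem_iota /= => hi.
    by rewrite hD //; lia.
  apply: uniq_perm; first exact: iota_uniq.
    rewrite map_inj_in_uniq ?iota_uniq // => i j; rewrite !mem_iota; lia.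
  move=> i; rewrite mem_iota; apply/idP/mapP => [hi|[j]].
    by exists (2 * N - i); rewrite ?mem_iota; lia.
  by rewrite mem_iota => hj ->; lia.
rewrite [X in _ + X = _]addnC addnA -big_split /=.
rewrite (eq_bigr (fun i => D i * pal_weight g (2 * N) i)); last by move=> i _; rewrite /pal_weight mulnDr addnC.
by rewrite iota0_cons // big_cons addnA.
Qed.

(** The last digit equals the leading one, hence runs from 1 to [g - 1]; the middle digit has the
    single weight [g ^ N]. *)
Definition pal_list g N :=
  [seq a * pal_weight g (2 * N) 0 + w | a <- iota 1 g.-1,
     w <- digit_sums g ([seq pal_weight g (2 * N) i | i <- iota 1 N.-1] ++ [:: g ^ N])].

Lemma mem_digit_sums_cat g s t v : v \in digit_sums g (s ++ t) <-> exists2 x, x \in digit_sums g s & exists2 y, y \in digit_sums g t & v = x + y.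
Proof.
elim: s v => [|n s IH] v /=.
  split=> [hv|[x]]; first by exists 0; rewrite ?inE //; exists v.
  by rewrite inE => /eqP -> [y hy ->].
split.
  move=> /allpairsP[[k u] /= [hk /IH[x hx [y hy ->]] ->]].
  exists (k * n + x); last by exists y; rewrite ?addnA.
  by apply/allpairsP; exists (k, x).
move=> [x /allpairsP[[k u] /= [hk hu ->]] [y hy ->]].
apply/allpairsP; exists (k, u + y); split => //=; last by rewrite addnA.
by apply/IH; exists u => //; exists y.
Qed.

Lemma mem_pal_list g N n : 1 < g -> 0 < N -> n \in pal_list g N <-> is_palindrome g (2 * N).+1 n.
Proof.
move=> g1 N0; have g0 : 0 < g by lia.
have ui : uniq (iota 1 N.-1) by apply: iota_uniq.
split.
  move=> /allpairsP[[a w] /= [ha /mem_digit_sums_cat[x /(digit_sums_mapP _ _ _ _ ui g0)[f [hf ->]]] [y hy ->] ->]].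
  have [e he ->] : exists2 e, e < g & y = e * g ^ N.
    move: hy => /allpairsP[[e z] /= [he]]; rewrite inE => /eqP -> ->.
    by exists e; [move: he; rewrite mem_iota|rewrite addn0].
  have {}ha : 0 < a < g by move: ha; rewrite mem_iota; lia.
  (* [h] gives the digits of the lower half including the middle; [D] extends it by reflection in
     [N]. *)
  pose h i := if i == 0 then a else if i == N then e else f i.
  pose D i := h (minn i (2 * N - i)).
  have hD i : D i < g by rewrite /D /h; case: ifP => _; [lia|case: ifP].
  have hs : forall i, i <= 2 * N -> D (2 * N - i) = D i.
    by move=> i hi; rewrite /D minnC; congr (h (minn _ _)); lia.
  have D0 : D 0 = a by rewrite /D min0n.
  have DN : D N = e.
    rewrite /D /h; have -> : minn N (2 * N - N) = N by lia.
    by rewrite eqxx ifF //; lia.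
  have Df i : i \in iota 1 N.-1 -> D i = f i.
    rewrite mem_iota => hi; rewrite /D; have -> : minn i (2 * N - i) = i by lia.
    by rewrite /h ifF ?ifF //; lia.
  apply/existsP; exists [ffun i : 'I_((2 * N).+1) => Ordinal (hD i)].
  apply/andP; split; first (apply/and3P; split => //).
  - apply/eqP; rewrite (eq_bigr (fun i : 'I_(2 * N).+1 => D i * g ^ i)); last first.
      by move=> i _; rewrite ffunE.
    rewrite big_palindromic // D0 DN; congr (_ + (_ + _)).
    by rewrite [LHS]big_seq [RHS]big_seq; apply: eq_bigr => i hi; rewrite Df.
  - apply/forallP => i; apply/implyP => /eqP[hi]; rewrite ffunE /= hi -hs // subnn D0; lia.
  - apply/forallP => i; rewrite !ffunE; apply/eqP/val_inj => /=.
    by rewrite subSS hs // -ltnS ltn_ord.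
move=> /existsP[d /andP[/and3P[_ /eqP -> /forallP hd] /forallP hp]].
pose D i := nat_of_ord (d (inord i)).
have hs : forall i, i <= 2 * N -> D (2 * N - i) = D i.
  move=> i hi; rewrite /D; have /eqP -> := hp (inord i); congr (nat_of_ord (d _)).
  by apply/val_inj; rewrite /= !inordK; lia.
have hD i : D i < g by apply: ltn_ord.
have -> : \sum_(i < (2 * N).+1) d i * g ^ i = \sum_(i < (2 * N).+1) D i * g ^ i.
  by apply: eq_bigr => i _; rewrite /D inord_val.
rewrite big_palindromic //; apply/allpairsP.
exists (D 0, \sum_(i <- iota 1 N.-1) D i * pal_weight g (2 * N) i + D N * g ^ N); split => //=.
  have := hd ord_max; rewrite eqxx /= -lt0n => h.
  have -> : D 0 = d ord_max.
    by rewrite -hs // subn0 /D; congr (nat_of_ord (d _)); apply/val_inj; rewrite /= inordK.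
  by rewrite mem_iota h; have := ltn_ord (d ord_max); lia.
apply/mem_digit_sums_cat; exists (\sum_(i <- iota 1 N.-1) D i * pal_weight g (2 * N) i).
  by apply/digit_sums_mapP => //; exists D.
exists (D N * g ^ N) => //; apply/allpairsP; exists (D N, 0); split => //=; last by rewrite addn0.
by rewrite mem_iota /=.
Qed.

(** Modulo [g ^ (N + 1)] the weights of positions 0 to [N] become the powers of [g], so uniqueness
    of expansions applies. Dropping the sums with outer digit 0 leaves the list. *)
Lemma uniq_pal_list g N : 1 < g -> 0 < N -> uniq (pal_list g N).
Proof.
move=> g1 N0; have g0 : 0 < g by lia.
have : uniq (digit_sums g ([seq pal_weight g (2 * N) i | i <- iota 0 N] ++ [:: g ^ N])).
  apply: (@map_uniq _ _ (fun v => v %% g ^ N.+1)).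
  rewrite (@digit_sums_mod _ _ _ [seq g ^ i | i <- iota 0 N.+1]); last first.
    rewrite -[N.+1]addn1 iotaD !map_cat add0n; congr (_ ++ _).
    rewrite -!map_comp; apply/eq_in_map => i; rewrite mem_iota /= => hi.
    rewrite /pal_weight; have -> : 2 * N - i = (N - i - 1) + (N + 1) by lia.
    by rewrite expnD addnC modnMDl.
  have hp := perm_digit_sums_pow g N.+1 g0.
  rewrite (perm_uniq (perm_map _ hp)).
  have -> : [seq v %% g ^ N.+1 | v <- iota 0 (g ^ N.+1)] = iota 0 (g ^ N.+1).
    rewrite -[RHS]map_id; apply/eq_in_map => i; rewrite mem_iota /= add0n => hi.
    by rewrite modn_small.
  exact: iota_uniq.
rewrite (iota0_cons N) //= (iota0_cons g) //.
by rewrite allpairs_cons cat_uniq => /and3P[].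
Qed.

Lemma digit_sums1 g x : digit_sums g [:: x] = [seq n * x | n <- iota 0 g].
Proof. by rewrite /=; elim: (iota 0 g) => //= n s ->; rewrite addn0. Qed.

Lemma big_Pi (V : nmodType) g N (F : nat -> V) : 1 < g -> 0 < N ->
  (\sum_(m in Pi g (2 * N).+1) F m = \sum_(a <- iota 1 g.-1) \sum_(e <- iota 0 g)
     \sum_(v <- digit_sums g [seq pal_weight g (2 * N) i | i <- iota 1 N.-1])
        F (a * pal_weight g (2 * N) 0 + e * g ^ N + v)%N)%R.
Proof.
move=> g1 N0.
transitivity (\sum_(n <- pal_list g N) F n)%R.
  rewrite -big_enum -(big_map (@nat_of_ord _) xpredT F) /=; apply: perm_big; apply: uniq_perm.
  - by rewrite map_inj_uniq ?enum_uniq //; apply: val_inj.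
  - exact: uniq_pal_list.
  move=> n; apply/mapP/idP => [[m]|hn].
    by rewrite mem_enum inE => hm ->; apply/mem_pal_list.
  have hp : is_palindrome g (2 * N).+1 n by apply/mem_pal_list.
  by exists (Ordinal (palindrome_lt hp)) => //; rewrite mem_enum inE.
rewrite /pal_list (big_allpairs_dep (idx := 0%R)); apply: eq_bigr => a _.
rewrite (big_digit_sums_cat V _ _ _ (fun w => F (_ + w))) exchange_big digit_sums1 big_map; apply: eq_bigr => e _.
apply: eq_bigr => v _; congr (F _); lia.
Qed.

Lemma card_Pi g N : 1 < g -> 0 < N -> #|Pi g (2 * N).+1| = (g - 1) * g ^ N.
Proof.
move=> g1 N0; have := big_Pi nat g N (fun=> 1) g1 N0.
rewrite sum1_card => ->.
under eq_bigr => a _ do under eq_bigr => e _ do rewrite sum1_size size_digit_sums size_map size_iota.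
rewrite !big_const_seq !count_predT !size_iota !iter_addn_0 -subn1 mulnC.
by rewrite -expnSr -subSn // subSS subn0 subn1.
Qed.

Local Open Scope ring_scope.

(** * The main term *)

Definition free_weights g N := [seq pal_weight g (2 * N) i | i <- iota 1 N.-1].
(** The bound [g ^ (2N+2)] exceeds every palindrome of length [2N+1]. *)
Definition sieve g N := [seq p <- iota 0 (g ^ (2 * N + 2)) | prime p & coprime p (2 * g)]%N.

Lemma distinct_primes_sieve g N : distinct_primes (sieve g N).
Proof.
rewrite /distinct_primes filter_uniq ?iota_uniq //=; apply/allP => p.
by rewrite mem_filter => /andP[/andP[]].
Qed.

Lemma sieve_coprime g N : all (fun p => coprime p g) (sieve g N) /\ all (fun p => coprime p 2) (sieve g N).
Proof.
by split; apply/allP => p; rewrite mem_filter coprimeMr => /andP[/andP[_ /andP[]]].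
Qed.

Lemma digit_sums_dvd g s q v : all (fun x => q %| x)%N s -> v \in digit_sums g s -> (q %| v)%N.
Proof.
elim: s v => [|x s IH] v /=; first by rewrite inE => _ /eqP ->; rewrite dvdn0.
move=> /andP[qx qs] /allpairsP[[n u] /= [_ /(IH _ qs) qu ->]].
by rewrite dvdn_add // dvdn_mull.
Qed.

Lemma outer_le g N a e : (1 < g)%N -> (0 < N)%N -> (a < g)%N -> (e < g)%N ->
  (a * pal_weight g (2 * N) 0 + e * g ^ N <= g ^ (2 * N + 1))%N.
Proof.
move=> g1 N0 ag eg; rewrite /pal_weight expn0 subn0.
have gp : (0 < g)%N by lia.
have h1 : (g ^ N * g <= g ^ (2 * N))%N by rewrite -expnSr leq_pexp2l //; lia.
have h2 : (g <= g ^ N)%N by rewrite -{1}(expn1 g) leq_pexp2l.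
rewrite expnD expn1.
have h3 : (a * (1 + g ^ (2 * N)) <= g.-1 * (1 + g ^ (2 * N)))%N by rewrite leq_mul2r; apply/orP; right; lia.
have h4 : (e * g ^ N <= g.-1 * g ^ N)%N by rewrite leq_mul2r; apply/orP; right; lia.
move: h1 h2 h3 h4; have : g = g.-1.+1 by lia.
move: (g ^ (2 * N))%N (g ^ N)%N => x y; move: g.-1 => h -> {ag eg g1 gp}; nia.
Qed.

Lemma free_digit_sums_lt g N v : (1 < g)%N -> (0 < N)%N -> v \in digit_sums g (free_weights g N) -> (v < g ^ (2 * N))%N.
Proof.
move=> g1 N0; rewrite /free_weights (@pal_weight_shift g (2 * N) 1); [|lia..].
rewrite digit_sums_scale => /mapP[w hw ->].
have hw2 : (w < g ^ (2 * N - 2).+1)%N by apply: digit_sums_pal_lt hw => //; lia.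
have -> : (2 * N = (2 * N - 2).+2)%N by lia.
by rewrite expn1 (expnS g (2 * N - 2).+1) ltn_pmul2l //; lia.
Qed.

(** Modulo a divisor of [g] only the outer digit survives. For odd [g] every palindromic weight is
    even, so the parity is that of the middle digit. The gcd is positive and below [g ^ (2N + 2)],
    so any other prime dividing it lies in the sieve. *)
Lemma coprime_digits g N a b e f v w : (1 < g)%N -> (0 < N)%N ->
  (0 < a < g)%N -> (0 < b < g)%N -> (e < g)%N -> (f < g)%N ->
  v \in digit_sums g (free_weights g N) -> w \in digit_sums g (free_weights g N) ->
  let m := (a * pal_weight g (2 * N) 0 + e * g ^ N + v)%N in
  let n := (b * pal_weight g (2 * N) 0 + f * g ^ N + w)%N in
  coprime m n = [&& coprime (gcdn a b) g, (odd g ==> odd e || odd f)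
                  & ~~ has (fun p => p %| gcdn m n)%N (sieve g N)].
Proof.
move=> g1 N0 /andP[a0 ag] /andP[b0 bg] eg fg hv hw m n.
have gp : (0 < g)%N by lia.
have dg q x c u : (q %| g)%N -> u \in digit_sums g (free_weights g N) ->
    (q %| x * pal_weight g (2 * N) 0 + c * g ^ N + u)%N = (q %| x)%N.
  move=> qg hu; rewrite /pal_weight expn0 subn0 mulnDr muln1 -!addnA dvdn_addl //.
  have qX k : (0 < k)%N -> (q %| g ^ k)%N by move=> k0; apply: dvdn_trans qg _; apply: dvdn_exp.
  apply: dvdn_add; first by apply: dvdn_mull; apply: qX; lia.
  apply: dvdn_add; first by apply: dvdn_mull; apply: qX.
  apply: digit_sums_dvd hu; apply/allP => _ /mapP[i hi ->].
  by rewrite /pal_weight dvdn_add ?qX //; move: hi; rewrite mem_iota; lia.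
have od x c u : odd g -> u \in digit_sums g (free_weights g N) ->
    odd (x * pal_weight g (2 * N) 0 + c * g ^ N + u)%N = odd c.
  move=> og hu; rewrite /pal_weight !oddD !oddM oddD !oddX og !orbT /= andbF andbT /=.
  suff : (2 %| u)%N by rewrite dvdn2 => /negbTE ->; rewrite addbF.
  apply: digit_sums_dvd hu; apply/allP => _ /mapP[i hi ->].
  by rewrite /pal_weight dvdn2 oddD !oddX og !orbT.
have mlt : (0 < gcdn m n < g ^ (2 * N + 2))%N.
  rewrite gcdn_gt0 /m /pal_weight expn0 !addn_gt0 muln_gt0 a0 /=.
  have h1 := outer_le g N a e g1 N0 ag eg; have h2 := free_digit_sums_lt g N v g1 N0 hv.
  apply: leq_ltn_trans (dvdn_leq _ (dvdn_gcdl _ _)) _; first by rewrite !addn_gt0 muln_gt0 a0.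
  move: h1 h2; rewrite /pal_weight expn0 !expnD expn1 expnS expn1.
  have : (0 < g ^ (2 * N))%N by rewrite expn_gt0 gp.
  move: (g ^ (2 * N))%N (g ^ N)%N (g ^ (2 * N - 0))%N => x y z; nia.
apply/idP/and3P => [cmn|[c1 c2 /hasPn c3]].
  have nop p : prime p -> (p %| gcdn m n)%N -> False.
    by move=> pp; rewrite (eqP cmn) dvdn1 => /eqP p1; rewrite p1 in pp.
  split.
  - apply/negPn/negP => hc; have [p pp] : exists2 p, prime p & (p %| gcdn (gcdn a b) g)%N.
      exists (pdiv (gcdn (gcdn a b) g)); last exact: pdiv_dvd.
      apply: pdiv_prime; rewrite ltn_neqAle eq_sym hc /= gcdn_gt0 gp orbT //.
    rewrite !dvdn_gcd => /andP[/andP[pa pb] pg]; apply: (nop p pp).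
    by rewrite dvdn_gcd !dg ?pa.
  - apply/implyP => og; apply/negPn/negP; rewrite negb_or => /andP[ne nf].
    by apply: (nop 2%N isT); rewrite dvdn_gcd !dvdn2 !od // ne.
  - apply/hasPn => p hp; apply/negP; apply: nop.
    by have := allP (andP (distinct_primes_sieve g N)).2 p hp.
apply/negPn/negP => hc.
have h1 : (1 < gcdn m n)%N by move: mlt hc; rewrite /coprime; lia.
have pp := pdiv_prime h1; have pd := pdiv_dvd (gcdn m n).
set p := pdiv _ in pp pd.
case: (boolP (coprime p (2 * g))) => [cp|].
  have : p \in sieve g N.
    rewrite mem_filter pp cp mem_iota /=; case/andP: mlt => ? ?.
    by apply: leq_ltn_trans (dvdn_leq _ pd) _.
  by move/c3; rewrite pd.
rewrite prime_coprime // negbK Euclid_dvdM //.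
case: (boolP (p %| g)%N) => [pg _|npg].
  have : (p %| gcdn (gcdn a b) g)%N by move: pd; rewrite !dvdn_gcd !dg // pg => ->.
  by rewrite (eqP c1) dvdn1 => /eqP p1; rewrite p1 in pp.
rewrite orbF dvdn_prime2 // => /eqP p2.
have og : odd g by move: npg; rewrite p2 dvdn2 negbK.
move: pd; rewrite p2 dvdn_gcd !dvdn2 !od //; move: c2; rewrite og /=.
by case: (odd e); case: (odd f).
Qed.

(** For [d] dividing [g], [g/d - 1] outer digits are multiples of [d]. The Moebius sum of the square
    of this splits into three Euler products; the constant term gives 0 as [g] has a prime divisor,
    and [1 - 1/p = (1 - 1/p^2) p / (p + 1)]. *)
Lemma sum_coprime_outer (F : realFieldType) g : (1 < g)%N ->
  \sum_(a <- iota 1 g.-1) \sum_(b <- iota 1 g.-1) (coprime (gcdn a b) g)%:R =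
  g%:R ^+ 2 * \prod_(p <- primes g) (1 - (p%:R ^+ 2)^-1)
   * (1 - 2 / g%:R * \prod_(p <- primes g) (p%:R / (p%:R + 1))) :> F.
Proof.
move=> g1; have gp : (0 < g)%N by lia.
have g0 : g%:R != 0 :> F by rewrite pnatr_eq0; lia.
have hps : distinct_primes (primes g).
  by rewrite /distinct_primes primes_uniq; apply/allP => p; rewrite mem_primes => /andP[].
have hc a b : coprime (gcdn a b) g = ~~ has (fun p => p %| gcdn a b)%N (primes g).
  rewrite coprime_sym; case: (posnP (gcdn a b)) => [->|h].
    rewrite /coprime gcdn0; have -> : has (dvdn^~ 0%N) (primes g).
      by apply/hasP; exists (pdiv g); rewrite ?dvdn0 // mem_primes pdiv_prime // gp pdiv_dvd.
    by apply/negbTE; rewrite neq_ltn g1 orbT.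
  rewrite coprime_has_primes //; congr (~~ _); apply/hasP/hasP => -[p].
    by rewrite /= mem_primes => /and3P[pp _ pg] hp; exists p; rewrite // mem_primes in hp *; rewrite ?pp ?gp ?pg //; case/and3P: hp.
  by move=> hp pd; exists p => //=; move: hp; rewrite !mem_primes h pd => /andP[->].
rewrite (eq_bigr (fun a => \sum_(b <- iota 1 g.-1)
  moebius_sum (primes g) (fun d => (d %| gcdn a b)%N%:R))); last first.
  by move=> a _; apply: eq_bigr => b _; rewrite hc moebius_sum_dvd.
under eq_bigr => a _ do rewrite -moebius_sum_sum.
rewrite -moebius_sum_sum.
transitivity (moebius_sum (primes g) (fun d => (g%:R ^+ 2 * (d%:R ^+ 2)^-1 - 2 * g%:R * d%:R^-1) + 1 : F)).
  apply: eq_in_moebius_sum => d hd.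
  have ps0 : all (ltn 0) (primes g) by apply/allP => p; rewrite mem_primes => /andP[/prime_gt0].
  have d0 : (0 < d)%N := allP (sqfree_prods_gt0 _ ps0) d hd.
  have dg : (d %| g)%N.
    apply: dvdn_trans (sqfree_prods_dvd_prod _ _ hd) _; apply: prod_primes_dvd => //.
    by apply/allP => p; rewrite mem_primes => /and3P[].
  have hcount : \sum_(a <- iota 1 g.-1) (d %| a)%N%:R = g%:R / d%:R - 1 :> F.
    have : \sum_(a <- iota 1 (d * (g %/ d)) | (d %| a)%N) 1 = g%:R / d%:R :> F.
      rewrite sum_dvd_iota // big_const_seq count_predT size_iota iter_addr_0.
      by rewrite -{2}(divnK dg) natrM mulfK // pnatr_eq0; lia.
    rewrite mulnC divnK // big_mkcond => <-.
    have -> : iota 1 g = iota 1 g.-1 ++ [:: g] by case: (g) gp => // n _; rewrite -[in LHS](addn1 n) iotaD add1n.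
    by rewrite big_cat big_seq1 dg addrK; apply: eq_bigr => a _; case: ifP.
  transitivity ((\sum_(a <- iota 1 g.-1) (d %| a)%N%:R) * (\sum_(a <- iota 1 g.-1) (d %| a)%N%:R) : F).
    rewrite mulr_suml; apply: eq_bigr => a _; rewrite mulr_sumr; apply: eq_bigr => b _.
    by rewrite dvdn_gcd -natrM mulnb.
  by rewrite hcount; field; rewrite pnatr_eq0; lia.
have moebius_sumD (h1 h2 : nat -> F) : moebius_sum (primes g) (fun d => h1 d + h2 d) = moebius_sum (primes g) h1 + moebius_sum (primes g) h2.
  rewrite -[moebius_sum _ h2]opprK -[- moebius_sum _ h2]mulN1r -moebius_sumZ moebius_sumB; apply: eq_moebius_sum => d; by rewrite mulN1r opprK.
rewrite moebius_sumD -moebius_sumB !moebius_sumZ.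
rewrite [X in _ + X]moebius_sum_multiplicative //; last by move=> a b; rewrite mulr1.
rewrite (moebius_sum_multiplicative _ _ (fun d => (d%:R ^+ 2)^-1)); last 2 first.
- by rewrite expr1n invr1.
- by move=> a b; rewrite natrM exprMn invfM.
rewrite (moebius_sum_multiplicative _ _ (fun d => d%:R^-1)) ?invr1 //; last by move=> a b; rewrite natrM invfM.
have -> : \prod_(p <- primes g) (1 - 1) = 0 :> F.
  rewrite subrr; have : pdiv g \in primes g by rewrite mem_primes pdiv_prime // gp pdiv_dvd.
  by case: (primes g) => // p s _; rewrite big_cons mul0r.
have -> : \prod_(p <- primes g) (1 - p%:R^-1) =
   \prod_(p <- primes g) (1 - (p%:R ^+ 2)^-1) * \prod_(p <- primes g) (p%:R / (p%:R + 1)) :> F.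
  rewrite -big_split /= [LHS]big_seq [RHS]big_seq; apply: eq_bigr => p.
  rewrite mem_primes => /andP[/prime_gt0 p0 _].
  by field; rewrite natr1 !pnatr_eq0; lia.
by rewrite addr0; field.
Qed.

(** For odd [g] exactly [(g + 1) / 2] digits are even, and the excluded pairs are those with both
    digits even. *)
Lemma sum_odd_middle (F : realFieldType) g : (1 < g)%N ->
  \sum_(e <- iota 0 g) \sum_(f <- iota 0 g) (odd g ==> odd e || odd f)%:R =
   (if odd g then g%:R ^+ 2 - ((g%:R + 1) / 2) ^+ 2 else g%:R ^+ 2) :> F.
Proof.
move=> g1; case: (boolP (odd g)) => og /=; last first.
  under eq_bigr => e _ do rewrite big_const_seq count_predT size_iota iter_addr_0.
  by rewrite big_const_seq count_predT size_iota iter_addr_0 -[LHS]mulr_natl expr2.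
have hev k : \sum_(e <- iota 0 k.*2.+1) (~~ odd e)%:R = k.+1%:R :> F.
  elim: k => [|k IH]; first by rewrite big_seq1.
  have -> : k.+1.*2.+1 = (k.*2.+1 + 2)%N by lia.
  rewrite iotaD big_cat IH /= !big_cons big_nil add0n /= odd_double /= !addr0 add0r natr1 //.
have -> : g%:R ^+ 2 - ((g%:R + 1) / 2) ^+ 2 =
   \sum_(e <- iota 0 g) \sum_(f <- iota 0 g) (1 - (~~ odd e)%:R * (~~ odd f)%:R) :> F.
  under [RHS]eq_bigr => e _ do rewrite sumrB -mulr_sumr big_const_seq count_predT size_iota iter_addr_0.
  rewrite sumrB -mulr_suml big_const_seq count_predT size_iota iter_addr_0 -mulr_natl.
  have -> : g = (g./2).*2.+1 by rewrite -{1}(odd_double_half g) og.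
  by rewrite hev -addn1 -muln2 -addn1 !natrD natrM; field.
apply: eq_bigr => e _; apply: eq_bigr => f _.
by case: (odd e); case: (odd f); rewrite ?mul0r ?mulr0 ?mul1r ?subr0 ?subrr.
Qed.

Lemma primes_mul2 g : (1 < g)%N ->
  perm_eq (primes (2 * g)) (if odd g then 2%N :: primes g else primes g).
Proof.
move=> g1; have gp : (0 < g)%N by lia.
apply: uniq_perm; rewrite ?primes_uniq //.
  case: ifP => og; rewrite ?primes_uniq //= primes_uniq andbT.
  by rewrite mem_primes /= dvdn2 og gp.
move=> p; rewrite primesM //.
case: ifP => og; first by rewrite inE.
have -> : primes 2 = [:: 2%N] by [].
by rewrite inE; case: (p =P 2%N) => // ->; rewrite mem_primes /= dvdn2 og gp.
Qed.

(** The prime divisors of [2g] and the sieve are disjoint and together contain every prime up to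
    [g ^ N]. *)
Lemma sieve_euler (R : realType) g N : (1 < g)%N -> (0 < N)%N ->
  `|zeta (2 : R) * \prod_(p <- primes (2 * g)) (1 - (p%:R ^+ 2)^-1)
     * \prod_(p <- sieve g N) (1 - (p%:R ^+ 2)^-1) - 1| <= 3 / g%:R ^+ N.
Proof.
move=> g1 N0; have gp : (0 < g)%N by lia.
have /andP[us ps] := distinct_primes_sieve g N.
rewrite -mulrA -big_cat -natrX; apply: zeta2_euler; first by rewrite expn_gt0 gp.
  rewrite /distinct_primes cat_uniq primes_uniq us all_cat ps /= !andbT; apply/andP; split; last first.
    by apply/allP => p; rewrite mem_primes => /andP[].
  apply/hasPn => p; rewrite mem_filter mem_primes => /andP[/andP[pp cp] _].
  by move: cp; rewrite prime_coprime // => /negbTE ->; rewrite !andbF.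
move=> p pp hp; rewrite mem_cat mem_filter mem_primes pp mem_iota /=.
rewrite muln_gt0 gp /= prime_coprime //; case: (p %| 2 * g)%N => //=.
by apply: leq_ltn_trans hp _; rewrite ltn_exp2l //; lia.
Qed.

Lemma prod_one_sub_in01 (F : realFieldType) ps : distinct_primes ps ->
  0 < \prod_(p <- ps) (1 - (p%:R ^+ 2)^-1 : F) <= 1.
Proof.
move=> /andP[_ hp]; elim: ps hp => [|p ps IH] /=; first by rewrite big_nil ltr01 lexx.
move=> /andP[pp /IH/andP[h0 h1]]; rewrite big_cons.
have p2 : 1 < p%:R :> F by rewrite ltr1n prime_gt1.
have p0 : 0 < p%:R ^+ 2 :> F by rewrite exprn_gt0 // (lt_trans ltr01).
rewrite mulr_gt0 //=; last by rewrite subr_gt0 invf_lt1 // exprn_egt1.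
apply: mulr_ile1; [|exact: ltW|by rewrite gerBl invr_ge0 ltW|exact: h1].
by rewrite subr_ge0 invf_le1 // exprn_ege1 // ltW.
Qed.

(** For fixed outer digits [a], [b] and middle digits [e], [f] the free digits contribute [G * K] up
    to a uniform relative error; the conditions on [(a, b)] and on [(e, f)] are independent and sum
    to [C1 * C2]. *)
Lemma card_coprime_main (R : realType) g : (1 < g)%N -> exists B (C : R), [/\ (6 <= B)%N, 0 <= C &
  forall N T, (0 < N)%N -> (B * T ^ 2 <= N)%N ->
  let C1 := \sum_(a <- iota 1 g.-1) \sum_(b <- iota 1 g.-1) (coprime (gcdn a b) g)%:R : R in
  let C2 := \sum_(e <- iota 0 g) \sum_(f <- iota 0 g) (odd g ==> odd e || odd f)%:R : R in
  let G := g%:R ^+ (2 * N.-1) in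
  `|\sum_(m in Pi g (2 * N).+1) \sum_(n in Pi g (2 * N).+1 | coprime m n) 1
     - C1 * C2 * G * \prod_(p <- sieve g N) (1 - (p%:R ^+ 2)^-1)| <= C1 * C2 * G * (C / g%:R ^+ T)].
Proof.
move=> g1; have [B [C [B6 C0 hC]]] := density_pairs R g g1.
have gp : (0 < g)%N by lia.
have g0 : 0 < g%:R :> R by rewrite ltr0n.
exists B, (C + 1); split; [by []|by rewrite addr_ge0|] => N T N0 hN; cbv zeta.
set C1 := \sum_(a <- iota 1 g.-1) _; set C2 := \sum_(e <- iota 0 g) _; set G := g%:R ^+ (2 * N.-1).
set K := \prod_(p <- _) _; have /andP[K0 K1] := prod_one_sub_in01 R _ (distinct_primes_sieve g N).
rewrite -/K in K0 K1.
have G0 : 0 < G by rewrite exprn_gt0.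
have Gne : G != 0 by rewrite lt0r_neq0.
set V := digit_sums g (free_weights g N).
pose x a e := (a * pal_weight g (2 * N) 0 + e * g ^ N)%N.
pose S a e b f : R := \sum_(v <- V) \sum_(w <- V)
   (~~ has (fun p => p %| gcdn (x a e + v) (x b f + w))%N (sieve g N))%:R.
have hS a e b f : (0 < a < g)%N -> (0 < b < g)%N -> (e < g)%N -> (f < g)%N ->
    `|S a e b f - G * K| <= G * ((C + 1) / g%:R ^+ T).
  move=> /andP[a0 ag] /andP[b0 bg] eg fg.
  (* [density_pairs] requires a positive [T]. For [T = 0] both quantities lie between 0 and [G],
     which the [+ 1] in the constant covers. *)
  case: T hN => [_|T hN].
    have : 0 <= S a e b f <= G.
      apply/andP; split; first by apply: sumr_ge0 => v _; apply: sumr_ge0 => w _.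
      have -> : G = \sum_(v <- V) \sum_(w <- V) 1.
        under eq_bigr => v _ do rewrite big_const_seq count_predT iter_addr_0.
        rewrite big_const_seq count_predT iter_addr_0 -[RHS]mulr_natl -natrM.
        by rewrite /V size_digit_sums size_map size_iota -expnD addnn -mul2n natrX.
      by apply: ler_sum => v _; apply: ler_sum => w _; case: (~~ _).
    move=> /andP[s0 s1]; rewrite expr0 divr1.
    have h1 : 0 <= G * K by rewrite mulr_ge0 // ltW.
    have h2 : G * K <= G by rewrite ler_piMr // ltW.
    have h3 : G <= G * (C + 1) by rewrite ler_peMr ?(ltW G0) // lerDr.
    by rewrite ler_norml; apply/andP; split; lra.
  have px a' e' : (0 < a')%N -> (0 < x a' e')%N by move=> h; rewrite /x /pal_weight !addn_gt0 muln_gt0 h addn_gt0 expn_gt0 gp.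
  have := hC (sieve g N) N T.+1 (x a e) (x b f) (distinct_primes_sieve g N) (sieve_coprime g N).1 (sieve_coprime g N).2
    isT hN (px _ _ a0) (outer_le g N a e g1 N0 ag eg) (px _ _ b0) (outer_le g N b f g1 N0 bg fg).
  rewrite -/K => h.
  have -> : S a e b f = G * moebius_sum (sieve g N) (fun d => density R g N d (x a e) * density R g N d (x b f)).
    rewrite /S /V /free_weights (count_coprime_pairs R _ g N _ _ (distinct_primes_sieve g N)) -moebius_sumZ.
    apply: eq_moebius_sum => d; rewrite /density mulrACA -invfM -exprD addnn -mul2n.
    by rewrite mulrCA mulfV ?mulr1.
  rewrite -mulrBr normrM (gtr0_norm G0) ler_pM2l //; apply: le_trans h _.
  by rewrite ler_wpM2r ?invr_ge0 ?exprn_ge0 ?(ltW g0) // lerDl.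
have -> : \sum_(m in Pi g (2 * N).+1) \sum_(n in Pi g (2 * N).+1 | coprime m n) 1 =
   \sum_(a <- iota 1 g.-1) \sum_(b <- iota 1 g.-1) \sum_(e <- iota 0 g) \sum_(f <- iota 0 g)
     ((coprime (gcdn a b) g)%:R * (odd g ==> odd e || odd f)%:R * S a e b f) :> R.
  transitivity (\sum_(m in Pi g (2 * N).+1) \sum_(n in Pi g (2 * N).+1) ((coprime m n)%:R : R)).
    by apply: eq_bigr => m _; rewrite big_mkcondr; apply: eq_bigr => n _; case: (coprime _ _).
  rewrite (big_Pi R g N (fun m => \sum_(n in Pi g (2 * N).+1) ((coprime m n)%:R : R)) g1 N0).
  rewrite [LHS]big_seq [RHS]big_seq; apply: eq_bigr => a; rewrite mem_iota => ha.
  transitivity (\sum_(e <- iota 0 g) \sum_(v <- V) \sum_(b <- iota 1 g.-1) \sum_(f <- iota 0 g) \sum_(w <- V)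
      ((coprime (x a e + v) (x b f + w))%:R : R)).
    apply: eq_bigr => e _; apply: eq_bigr => v _.
    exact: (big_Pi R g N (fun n => (coprime (x a e + v) n)%:R) g1 N0).
  under eq_bigr => e _ do rewrite exchange_big.
  rewrite exchange_big /= [LHS]big_seq [RHS]big_seq; apply: eq_bigr => b; rewrite mem_iota => hb.
  rewrite [LHS]big_seq [RHS]big_seq; apply: eq_bigr => e; rewrite mem_iota => he.
  rewrite exchange_big /= [LHS]big_seq [RHS]big_seq; apply: eq_bigr => f; rewrite mem_iota => hf.
  rewrite /S mulr_sumr [LHS]big_seq [RHS]big_seq; apply: eq_bigr => v hv.
  rewrite mulr_sumr [LHS]big_seq [RHS]big_seq; apply: eq_bigr => w hw.
  rewrite /x (coprime_digits g N a b e f v w) //; try lia.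
  by rewrite -!natrM !mulnb andbA.
have hC12 D : C1 * C2 * D = \sum_(a <- iota 1 g.-1) \sum_(b <- iota 1 g.-1) \sum_(e <- iota 0 g) \sum_(f <- iota 0 g)
     ((coprime (gcdn a b) g)%:R * (odd g ==> odd e || odd f)%:R * D).
  rewrite -mulrA mulr_suml; apply: eq_bigr => a _; rewrite mulr_suml; apply: eq_bigr => b _.
  rewrite /C2 mulr_suml mulr_sumr; apply: eq_bigr => e _.
  by rewrite mulr_suml mulr_sumr; apply: eq_bigr => f _; rewrite mulrA.
rewrite -(mulrA _ G) -[leRHS]mulrA !hC12.
rewrite -sumrB; apply: le_trans (ler_norm_sum _ _ _) _; rewrite big_seq [leRHS]big_seq; apply: ler_sum => a ha.
rewrite -sumrB; apply: le_trans (ler_norm_sum _ _ _) _; rewrite big_seq [leRHS]big_seq; apply: ler_sum => b hb.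
rewrite -sumrB; apply: le_trans (ler_norm_sum _ _ _) _; rewrite big_seq [leRHS]big_seq; apply: ler_sum => e he.
rewrite -sumrB; apply: le_trans (ler_norm_sum _ _ _) _; rewrite big_seq [leRHS]big_seq; apply: ler_sum => f hf.
rewrite !mem_iota in ha hb he hf.
rewrite -mulrBr normrM ger0_norm ?mulr_ge0 // ler_wpM2l ?mulr_ge0 // hS //; lia.
Qed.

Theorem theorem1p1 (R : realType) (g : nat) (hg : (2 <= g)%N) :
  exists c C : R, 0 < c /\ 0 < C /\
    forall N : nat, (1 <= N)%N ->
      exists E : R,
        \sum_(m in Pi g (2 * N + 1)) \sum_(n in Pi g (2 * N + 1) | coprime m n) 1
          = rho R g / zeta (2 : R)
            * (1 - 2 / g%:R * \prod_(p <- primes g) (p%:R / (p%:R + 1)))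
            * (#|Pi g (2 * N + 1)|)%:R ^+ 2 * (1 + E)
        /\ `|E| <= C * g%:R `^ (- (c * Num.sqrt N%:R)).
Proof.
have [B [C [B6 C0 hC]]] := card_coprime_main R g hg.
have gp : (0 < g)%N by lia.
have g0 : 0 < g%:R :> R by rewrite ltr0n.
have g1 : 1 <= g%:R :> R by rewrite ler1n.
have B0 : 0 < B%:R :> R by rewrite ltr0n; lia.
set P : R := \prod_(p <- primes (2 * g)) (1 - (p%:R ^+ 2)^-1).
have hP : distinct_primes (primes (2 * g)).
  by rewrite /distinct_primes primes_uniq; apply/allP => p; rewrite mem_primes => /andP[].
have /andP[P0 P1] := prod_one_sub_in01 R _ hP; rewrite -/P in P0 P1.
set z : R := zeta 2.
have z0 : 0 < z.
  have /andP[h _] := zeta2_partial R 1 isT; apply: lt_le_trans h.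
  by rewrite big_seq1 expr1n invr1.
set X : R := 1 - 2 / g%:R * \prod_(p <- primes g) (p%:R / (p%:R + 1)).
(* The error comes out as a multiple of [g ^ (-T)] with [T + 1 > sqrt (N / B)]: this gives [c], and
   the extra factor [g] in [C] pays for replacing [T] by [T + 1]. *)
exists (Num.sqrt B%:R)^-1, (g%:R * (z * P * C + 3)).
have z3 : 0 < z * P * C + 3 by rewrite ltr_wpDl // !mulr_ge0 // ltW.
split; first by rewrite invr_gt0 sqrtr_gt0.
split; first by rewrite mulr_gt0.
move=> N N0; rewrite addn1.
have [T hT] : exists T, (B * T ^ 2 <= N < B * T.+1 ^ 2)%N.
  have ex : exists T, (B * T ^ 2 <= N)%N by exists 0%N; rewrite muln0.
  have bd T : (B * T ^ 2 <= N -> T <= N)%N.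
    by rewrite expnS expn1; nia.
  exists (ex_maxn ex bd); case: ex_maxnP => T hT hmax; rewrite hT ltnNge; apply/negP => /hmax.
  by rewrite ltnn.
case/andP: hT => hT hT2.
have TN : (T <= N)%N by move: hT; rewrite expnS expn1; nia.
have := hC N T N0 hT; cbv zeta.
set C1 := \sum_(a <- iota 1 g.-1) _; set C2 := \sum_(e <- iota 0 g) _; set G := g%:R ^+ (2 * N.-1).
set LHS := \sum_(m in _) _; set K := \prod_(p <- sieve g N) _.
move=> /= main; have G0 : 0 < G by rewrite exprn_gt0.
(* The pair [a = b = 1] is admissible; this positivity later makes the main term [M] nonzero. *)
have C10 : 0 < C1.
  rewrite /C1; have -> : iota 1 g.-1 = 1%N :: iota 2 g.-2 by case: (g) hg => [|[]].
  by rewrite !big_cons gcd1n /coprime gcd1n -addrA ltr_pwDl // addr_ge0 ?sumr_ge0 // => a _; rewrite sumr_ge0.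
have C20 : 0 < C2.
  have g2 : 2 <= g%:R :> R by rewrite (ler_nat _ 2).
  by rewrite /C2 sum_odd_middle //; case: ifP => _; [nra|rewrite exprn_gt0].
(* This produces [rho]. For odd [g], [C2 = (3g + 1)(g - 1) / 4], and division by the factor [3/4] of
   [P] at the prime 2 gives [(g + 1/3)(g - 1)]; for even [g], [C2 = g^2] and 2 is already among the
   primes of [g]. *)
have eq_main : rho R g / z * X * (#|Pi g (2 * N).+1|)%:R ^+ 2 = C1 * C2 * G / (z * P).
  rewrite card_Pi // natrM natrX natrB // /C1 sum_coprime_outer // /C2 sum_odd_middle //.
  rewrite -/X /P (perm_big _ (primes_mul2 g hg)) /= /rho /G.
  have gn1 : g%:R - 1 != 0 :> R by rewrite subr_eq0 (eqr_nat _ g 1) neq_ltn hg orbT.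
  have zn0 := lt0r_neq0 z0; have gn0 := lt0r_neq0 g0.
  have hQ : distinct_primes (primes g).
    by rewrite /distinct_primes primes_uniq; apply/allP => p; rewrite mem_primes => /andP[].
  have /andP[Q0 _] := prod_one_sub_in01 R _ hQ.
  have eN : g%:R ^+ N = g%:R * g%:R ^+ N.-1 :> R by rewrite -exprS prednK.
  rewrite eN mul2n -addnn exprD.
  have hn0 : g%:R ^+ N.-1 != 0 :> R by rewrite expf_neq0.
  move: (lt0r_neq0 Q0) hn0; set Q := \prod_(p <- primes g) _; set h := g%:R ^+ N.-1 => Qn0 hn0.
  case: ifP => og; last first.
    by rewrite -/Q; field; rewrite Qn0 zn0 gn1.
  by rewrite big_cons -/Q; field; rewrite Qn0 zn0 gn1.
set M := rho R g / z * X * (#|Pi g (2 * N).+1|)%:R ^+ 2 in eq_main *.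
have M0 : 0 < M by rewrite eq_main divr_gt0 ?mulr_gt0.
have CG : C1 * C2 * G = M * (z * P) by rewrite eq_main divfK // lt0r_neq0 // mulr_gt0.
exists (LHS / M - 1); split.
  by rewrite addrCA subrr addr0 mulrCA divff ?mulr1 // lt0r_neq0.
have hK := sieve_euler R g N hg N0; rewrite -/P -/z -/K in hK.
(* One error comes from the count, the other from replacing the product over the sieve by
   [1 / (z * P)]. *)
have e1 : `|LHS / M - 1| <= z * P * (C / g%:R ^+ T) + 3 / g%:R ^+ N.
  have -> : LHS / M - 1 = (LHS - C1 * C2 * G * K) / M + (z * P * K - 1).
    by rewrite CG; field; rewrite lt0r_neq0.
  apply: le_trans (ler_normD _ _) _; apply: lerD => //.
  rewrite normrM normfV (gtr0_norm M0) ler_pdivrMr //; apply: le_trans main _.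
  by rewrite CG le_eqVlt; apply/orP; left; apply/eqP; ring.
apply: le_trans e1 _.
apply: (@le_trans _ _ ((z * P * C + 3) / g%:R ^+ T)).
  rewrite [leRHS]mulrDl [X in X + _ <= _]mulrA lerD2l ler_wpM2l // lef_pV2 ?posrE ?exprn_gt0 //.
  by rewrite -!natrX ler_nat leq_pexp2l.
set Y := _ + 3 in z3 *; rewrite [g%:R * Y]mulrC -mulrA ler_wpM2l ?(ltW z3) //.
have -> : (g%:R ^+ T)^-1 = g%:R * g%:R `^ (- (T.+1)%:R) :> R.
  by rewrite powRN powR_mulrn ?(ltW g0) // exprS invfM mulrA divff ?mul1r // lt0r_neq0.
rewrite ler_wpM2l ?(ltW g0) // ler_powR // lerN2.
rewrite mulrC ler_pdivrMr ?sqrtr_gt0 //.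
have -> : T.+1%:R = Num.sqrt (T.+1%:R ^+ 2) :> R by rewrite sqrtr_sqr ger0_norm.
rewrite -sqrtrM ?exprn_ge0 // ler_wsqrtr // -natrX -natrM ler_nat mulnC ltnW //.
Qed.
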